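(* Let $d\ge 2$, $D=\{1,\dots,d\}$, let $B\subset D$ with $|B|>1$, $B'=D\setminus B$, and let $\varphi:[0,\infty)\to[0,\infty)$ be a nondecreasing function satisfying $$\varphi(x)=o\left(x\log^{|B|-1}x\right)\quad\text{as }x\to+\infty.$$ Then there exists a function $f\in L_1(\mathbb{I}^d)$ such that a) $$\int_{\mathbb{I}^d}\varphi(|f|)<\infty;$$ b) the logarithmic means $(L_{n_B}\circ R_{n_{B'}})(f)$ of the rectangular partial sums of the multiple Walsh-Fourier series of $f$ diverge in measure on $\mathbb{I}^d$, i.e. they do not converge in measure to any a.e. finite measurable function as $n_i\to\infty$ for all $i\in D$ (as $\min_{i\in D}n_i\to\infty$).
   Context: $\mathbb{I}^d=[0,1)^d$ with Lebesgue measure; functions on $\mathbb{I}^d$ are identified with their $1$-periodic extensions in each variable. $|B|$ is the number of elements of $B$. Walsh system: $r_0(x)=1$ for $x\in[0,1/2)$, $r_0(x)=-1$ for $x\in[1/2,1)$, extended $1$-periodically; $r_n(x)=r_0(2^nx)$. $w_0=1$, and if $n=2^{m_1}+\dots+2^{m_s}$ with $m_1>\dots>m_s\ge 0$, then $w_n=r_{m_1}\cdots r_{m_s}$. For $f\in L_1(\mathbb{I}^d)$ put $\widehat f(j_1,\dots,j_d)=\int_{\mathbb{I}^d}f(\mathbf{x})\prod_{i=1}^d w_{j_i}(x_i)\,d\mathbf{x}$, and for positive integers $N_1,\dots,N_d$ define the rectangular partial sum $$S_{N_1,\dots,N_d}(f;\mathbf{x})=\sum_{j_1=0}^{N_1-1}\cdots\sum_{j_d=0}^{N_d-1}\widehat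 f(j_1,\dots,j_d)\prod_{i=1}^d w_{j_i}(x_i).$$ Mixed logarithmic means: with $l_n=\sum_{k=1}^{n-1}\frac1k$, for integers $n_1,\dots,n_d\ge2$, $$(L_{n_B}\circ R_{n_{B'}})(f;\mathbf{x})=\frac{1}{\prod_{j\in D}l_{n_j}}\sum_{i_1=1}^{n_1-1}\cdots\sum_{i_d=1}^{n_d-1}\frac{S_{N_1,\dots,N_d}(f;\mathbf{x})}{i_1i_2\cdots i_d},\qquad N_j=n_j-i_j\ (j\in B),\quad N_j=i_j\ (j\in B').$$ *)

(* Defs.v *)
From HB Require Import structures.
From mathcomp Require Import all_boot all_order all_algebra.
From mathcomp Require Import all_classical all_reals all_analysis.
From mathcomp Require Import measurable_realfun.
From mathcomp Require Import zify.

Set Implicit Arguments.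
Unset Strict Implicit.
Unset Printing Implicit Defensive.
Import Order.TTheory GRing.Theory Num.Theory.
Import numFieldNormedType.Exports.
Local Open Scope classical_set_scope.
Local Open Scope ring_scope.

Section cons_product_measure.
Local Open Scope ereal_scope.
Context {R : realType} (n : nat).
Variable mu : {sigma_finite_measure set (n.-tuple (measurableTypeR R)) -> \bar R}.

Definition cons_pair (p : measurableTypeR R * n.-tuple (measurableTypeR R)) :
  n.+1.-tuple (measurableTypeR R) := [the n.+1.-tuple _ of p.1 :: p.2].

Definition uncons_pair (t : n.+1.-tuple (measurableTypeR R)) :
  measurableTypeR R * n.-tuple (measurableTypeR R) :=
  (tnth t ord0, [tuple of behead t]).

Lemma measurable_cons_pair : measurable_fun [set: _] cons_pair.
Proof. exact: measurable_cons. Qed.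

Lemma measurable_uncons_pair : measurable_fun [set: _] uncons_pair.
Proof.
apply: measurable_fun_pair; first exact: measurable_tnth.
exact: measurable_behead.
Qed.

Lemma cons_pairK : cancel cons_pair uncons_pair.
Proof. by case=> a t; rewrite /uncons_pair/=; congr pair; exact: val_inj. Qed.

Lemma uncons_pairK : cancel uncons_pair cons_pair.
Proof.
by move=> t; rewrite [RHS]tuple_eta; apply: val_inj => /=; rewrite /thead.
Qed.

Definition cons_product_measure :
    set (n.+1.-tuple (measurableTypeR R)) -> \bar R :=
  pushforward (@lebesgue_measure R \x mu) cons_pair.

Let cpm0 : cons_product_measure set0 = 0.
Proof. by rewrite /cons_product_measure /pushforward preimage_set0 measure0. Qed.

Let cpm_ge0 A : 0 <= cons_product_measure A.
Proof. by rewrite /cons_product_measure /pushforward; exact: measure_ge0. Qed.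

Let cpm_sigma_additive : semi_sigma_additive cons_product_measure.
Proof.
exact: (@measure_semi_sigma_additive _ _ _
  (measure_function_pushforward__canonical__measure_function_Measure
     (@lebesgue_measure R \x mu) measurable_cons_pair)).
Qed.

HB.instance Definition _ := isMeasure.Build _ _ _ cons_product_measure
  cpm0 cpm_ge0 cpm_sigma_additive.

Let cpm_sigma_finite : sigma_finite setT cons_product_measure.
Proof.
have /sigma_finiteP[F [TF ndF Foo]] := sigma_finiteT (@lebesgue_measure R).
have /sigma_finiteP[G [TG ndG Goo]] := sigma_finiteT mu.
exists (fun k => uncons_pair @^-1` (F k `*` G k)).
  rewrite -preimage_bigcup (_ : \bigcup_k _ = setT) ?preimage_setT//.
  apply/seteqP; split=> // -[x y] _.
  have : [set: measurableTypeR R] x by [].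
  have : [set: n.-tuple (measurableTypeR R)] y by [].
  rewrite TF TG => -[k _ Gky] [l _ Flx]; exists (maxn l k) => //; split.
  - by move: x Flx; exact/subsetPset/ndF/leq_maxl.
  - by move: y Gky; exact/subsetPset/ndG/leq_maxr.
move=> k; have [mF Fk] := Foo k; have [mG Gk] := Goo k; split.
  by rewrite -[X in measurable X]setTI; apply: measurable_uncons_pair => //;
    exact: measurableX.
rewrite /cons_product_measure /pushforward -comp_preimage.
rewrite (_ : _ \o _ = idfun); last by apply/funext => p /=; rewrite cons_pairK.
rewrite preimage_id product_measure1E//.
by rewrite lte_mul_pinfty// ge0_fin_numE.
Qed.

HB.instance Definition _ := Measure_isSigmaFinite.Build _ _ _
  cons_product_measure cpm_sigma_finite.

End cons_product_measure.

(* Lebesgue measure on R^n, as the n-fold product of the one-dimensional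
   Lebesgue measure; see lebesgue_tuple_box below. *)
Fixpoint lebesgue_tuple (R : realType) (n : nat) :
    {sigma_finite_measure set (n.-tuple (measurableTypeR R)) -> \bar R} :=
  match n with
  | 0 => @dirac _ _ ([tuple] : 0.-tuple (measurableTypeR R)) R
  | m.+1 => cons_product_measure (lebesgue_tuple R m)
  end.

Lemma measurable_box (R : realType) (n : nat)
    (A : 'I_n -> set (measurableTypeR R)) :
  (forall i, measurable (A i)) ->
  measurable [set t : n.-tuple (measurableTypeR R) | forall i, A i (tnth t i)].
Proof.
move=> mA.
rewrite (_ : [set _ | _] = \bigcap_(i in [set: 'I_n]) ((@tnth _ _)^~ i @^-1` A i)).
  apply: fin_bigcap_measurable => // i _.
  by rewrite -[X in measurable X]setTI; exact: measurable_tnth.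
by apply/seteqP; split=> [t At i _|t At i]; exact: At.
Qed.

Lemma lebesgue_tuple_box (R : realType) (n : nat)
    (A : 'I_n -> set (measurableTypeR R)) :
  (forall i, measurable (A i)) ->
  lebesgue_tuple R n [set t | forall i, A i (tnth t i)] =
  (\prod_(i < n) lebesgue_measure (A i))%E.
Proof.
elim: n A => [|n IH] A mA /=.
  by rewrite big_ord0 diracE mem_set// => -[].
rewrite /cons_product_measure /pushforward big_ord_recl -IH//.
have mbox := measurable_box (fun i => mA (lift ord0 i)).
rewrite -product_measure1E//; congr (_ _); apply/seteqP; split=> [[a t] /= At|[a t] /= [A0 At] i].
  by split=> [|i]; [exact: (At ord0)|have := At (lift ord0 i); rewrite tnthS].
by case: (unliftP ord0 i) => [j|] ->//; rewrite tnthS.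
Qed.

(* [0,1)^d *)
Definition unit_cube (R : realType) (d : nat) :
    set (d.-tuple (measurableTypeR R)) :=
  [set x | forall i, `[0, 1[%classic (tnth x i)].
Arguments unit_cube : clear implicits.

Definition rademacher0 (R : realType) (x : R) : R :=
  if x - (Num.floor x)%:~R < 2^-1 then 1 else -1.

Definition rademacher (R : realType) (n : nat) (x : R) : R :=
  rademacher0 (2 ^+ n * x).

(* The product runs over the positions m of the binary digits 1 of n; they
   satisfy m < n since n < 2 ^ n. *)
Definition walsh (R : realType) (n : nat) (x : R) : R :=
  \prod_(m < n | odd (n %/ 2 ^ m)) rademacher m x.

Lemma walsh_widen (R : realType) (n N : nat) (x : R) : (n <= N)%N ->
  walsh n x = \prod_(0 <= m < N | odd (n %/ 2 ^ m)) rademacher m x.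
Proof.
move=> nN; rewrite (@big_cat_nat _ _ _ n)//= [X in _ * X]big1_seq ?mulr1.
  by rewrite big_mkord.
move=> m /andP[]; rewrite mem_index_iota => /[swap] /andP[nm _].
by rewrite divn_small// (leq_ltn_trans nm)// ltn_expl.
Qed.

Lemma walsh0 (R : realType) (x : R) : walsh 0 x = 1.
Proof. by rewrite /walsh big_ord0. Qed.

Lemma walshD (R : realType) (m n : nat) (x : R) : (n < 2 ^ m)%N ->
  walsh (2 ^ m + n) x = rademacher m x * walsh n x.
Proof.
move=> nm; have mm : (m < 2 ^ m + n)%N by rewrite ltn_addr// ltn_expl.
rewrite (walsh_widen x (leqnn _)) (walsh_widen x (leq_addl (2 ^ m) n)).
rewrite !big_mkord.
rewrite (bigD1 (Ordinal mm))/=; last first.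
  by rewrite divnDl// divnn expn_gt0/= divn_small// addn0.
congr (_ * _); apply: eq_bigl => k.
have [->|km] := eqVneq k (Ordinal mm).
  by rewrite andbF/= divn_small.
rewrite andbT; have {}km : (k : nat) != m.
  by apply: contra_neq km => km; exact: val_inj.
have [lt_km|] := ltnP k m.
  rewrite divnDl; last by rewrite dvdn_exp2l// ltnW.
  by rewrite oddD -expnB ?(ltnW lt_km)// oddX subn_eq0 leqNgt lt_km.
rewrite leq_eqVlt eq_sym (negbTE km)/= => lt_mk.
have le2 : (2 ^ m.+1 <= 2 ^ k)%N by rewrite leq_exp2l.
by rewrite !divn_small//; move: le2; rewrite expnS; lia.
Qed.

Definition mwalsh (R : realType) (d : nat) (j : 'I_d -> nat)
    (x : d.-tuple (measurableTypeR R)) : R :=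
  \prod_(i < d) walsh (j i) (tnth x i).

Definition walsh_coef (R : realType) (d : nat)
    (f : d.-tuple (measurableTypeR R) -> R) (j : 'I_d -> nat) : R :=
  \int[lebesgue_tuple R d]_(x in unit_cube R d) (f x * mwalsh j x).

(* Sum of F j over the multi-indices j with a <= j_i < b_i for all i; the bound
   on the type of the components of j is only there to make it finite. *)
Definition box_sum (V : nmodType) (d : nat) (a : nat) (b : 'I_d -> nat)
    (F : ('I_d -> nat) -> V) : V :=
  \sum_(j : {ffun 'I_d -> 'I_(\max_(i < d) b i)} | [forall i, (a <= j i < b i)%N])
    F (fun i => j i).

Definition walsh_partial_sum (R : realType) (d : nat) (N : 'I_d -> nat)
    (f : d.-tuple (measurableTypeR R) -> R)
    (x : d.-tuple (measurableTypeR R)) : R :=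
  box_sum 0 N (fun j => walsh_coef f j * mwalsh j x).

Definition log_norm (R : realType) (n : nat) : R :=
  \sum_(1 <= k < n) (k%:R)^-1.

(* Noerlund type in the variables of B, Riesz type in the other ones. *)
Definition mixed_log_mean (R : realType) (d : nat) (B : {set 'I_d})
    (n : 'I_d -> nat) (f : d.-tuple (measurableTypeR R) -> R)
    (x : d.-tuple (measurableTypeR R)) : R :=
  (\prod_(j < d) log_norm R (n j))^-1 *
  box_sum 1 n (fun i =>
    walsh_partial_sum
      (fun j => if j \in B then (n j - i j)%N else i j) f x
    / \prod_(j < d) (i j)%:R).

(* The filter on multi-indices of "min_i n_i -> oo". *)
Definition min_oo (d : nat) : set_system ('I_d -> nat) :=
  filter_from [set: nat] (fun N => [set n | forall i, (N <= n i)%N]).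
Arguments min_oo : clear implicits.

#[global] Instance min_oo_filter (d : nat) : ProperFilter (min_oo d).
Proof.
apply: filter_from_proper; last by move=> N _; exists (fun=> N).
apply: filter_from_filter; first by exists 0%N.
move=> M N _ _; exists (maxn M N) => // n /= MN.
by split=> i /=; rewrite (leq_trans _ (MN i))// ?leq_maxl ?leq_maxr.
Qed.

Definition cvg_in_measure (R : realType) (disp : measure_display)
    (T : measurableType disp) (mu : set T -> \bar R) (D : set T) (I : Type)
    (G : set_system I) (F : I -> T -> R) (g : T -> \bar R) : Prop :=
  forall e : R, 0 < e ->
    mu (D `&` [set x | (e%:E <= `|(F n x)%:E - g x|)%E]) @[n --> G] --> 0%E.

(* Main.v *)
Require Import Defs.
From mathcomp Require Import all_boot all_order all_algebra.
From mathcomp Require Import all_classical all_reals all_analysis.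
From mathcomp Require Import measurable_realfun.
From mathcomp Require Import zify ring lra.
Set Implicit Arguments.
Unset Strict Implicit.
Unset Printing Implicit Defensive.
Import Order.TTheory GRing.Theory Num.Theory.
Import numFieldNormedType.Exports.
Local Open Scope classical_set_scope.
Local Open Scope ring_scope.

(* For n = 1 + 4 + ... + 4^(a-1) the one-dimensional Noerlund logarithmic kernel
   is at least 4^t / 10 in absolute value on the dyadic shell 2^(-2t-1) <= u < 2^(-2t),
   for every t between 0.9 a and a.  The product of b = |B| such kernels exceeds
   4^S / 10^b on all products of shells with t_1 + ... + t_b = S, and about a^(b-1)
   of them fit: the weak type constant of the means is therefore of order a^(b-1).
   Randomly signed and randomly translated multiples of the tensor product of
   b Dirac-like bumps then give a step function f, large where it is nonzero, with
   small integrals of |f| and of phi(2|f|), whose mean exceeds a given M on a set of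
   measure 1/4.  If the means of every admissible function converged in measure,
   those of every partial sum would be bounded in measure, and a gliding hump sum of
   such step functions would have means unbounded in measure. *)

(** The growth condition on [phi] is matched to the gain a^(b-1) as follows. The bumps live on
    dyadic cells of side 2^(-2a), so the logarithm of the values of f is O(a), and phi(2|f|) is o(1)
    times |f| a^(b-1); the hump itself needs only an L1 norm of order M / a^(b-1). Both powers
    cancel and a small constant remains. The obstacle is that the kernels change sign, so that the
    means of superposed bumps may cancel; the random signs are there to rule this out. Outside B the
    bumps are constant, and Riesz means preserve constants, so only the Noerlund factors are left.
    All coordinates of the order equal one n <= 2^(2a); the means of these step functions then
    depend on the cell only, and the probabilistic argument becomes counting in a finite set. In the
    gliding hump, boundedness in measure is used twice: at each stage, to keep the means of the
    earlier sum from hiding the new hump, and for the final sum. *)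

(** * Walsh functions of binary digit sequences *)

Section walsh_on_bits.
Context {R : realFieldType}.
Implicit Types (u v : nat -> bool) (j k m n q r s : nat).

(** A point is represented by its digits, so that dyadic translation is the pointwise [(+)] and the
    kernels can be studied without real arguments. *)
Definition walsh_bits j u : R :=
  \prod_(m < j | odd (j %/ 2 ^ m)) (-1) ^+ u m.

Lemma walsh_bits_widen n j u : (j <= n)%N ->
  walsh_bits j u = \prod_(m < n | odd (j %/ 2 ^ m)) (-1) ^+ u m.
Proof.
move=> jn; rewrite /walsh_bits.
rewrite (big_ord_widen_cond _ (fun m => odd (j %/ 2 ^ m)) (fun m => (-1) ^+ u m) jn).
apply: eq_bigl => m; case: ltnP => [|jm]; first by rewrite andbT.
by rewrite andbF divn_small// (leq_ltn_trans jm)// ltn_expl.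
Qed.

Lemma walsh_bits0 u : walsh_bits 0 u = 1.
Proof. by rewrite /walsh_bits big_ord0. Qed.

Lemma walsh_bits_rec j u :
  walsh_bits j u = (-1) ^+ (odd j && u 0%N) * walsh_bits j./2 (u \o succn).
Proof.
rewrite (walsh_bits_widen _ (leqnSn j)) big_mkcond big_ord_recl/= expn0 divn1.
congr (_ * _); first by case: (odd j).
have jj : (j./2 <= j)%N by lia.
rewrite (walsh_bits_widen _ jj) [RHS]big_mkcond/=; apply: eq_bigr => i _.
by rewrite /bump/= add1n expnS divnMA divn2.
Qed.

Lemma walsh_bits_xor j u v :
  walsh_bits j (fun m => u m (+) v m) = walsh_bits j u * walsh_bits j v.
Proof.
by rewrite /walsh_bits -big_split/=; apply: eq_bigr => m _; rewrite signr_addb.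
Qed.

Lemma norm_walsh_bits j u : `|walsh_bits j u| = 1.
Proof.
by rewrite /walsh_bits normr_prod big1// => m _; rewrite normr_sign.
Qed.

Lemma walsh_bitsD k q r u : (r < 2 ^ k)%N ->
  walsh_bits (q * 2 ^ k + r) u = walsh_bits (q * 2 ^ k) u * walsh_bits r u.
Proof.
elim: k r u => [|k ih] r u.
  by rewrite expn0 ltnS leqn0 => /eqP ->; rewrite addn0 walsh_bits0 mulr1.
rewrite expnS => rk.
rewrite walsh_bits_rec [in RHS]walsh_bits_rec [walsh_bits r u]walsh_bits_rec.
have -> : odd (q * (2 * 2 ^ k) + r) = odd r by rewrite oddD mulnCA mul2n odd_double.
have -> : odd (q * (2 * 2 ^ k)) = false by rewrite mulnCA mul2n odd_double.
have -> : ((q * (2 * 2 ^ k) + r)./2 = q * 2 ^ k + r./2)%N.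
  by rewrite mulnCA mul2n; lia.
have -> : ((q * (2 * 2 ^ k))./2 = q * 2 ^ k)%N by rewrite mulnCA mul2n doubleK.
rewrite ih/=; first by rewrite expr0 mul1r; ring.
by lia.
Qed.

Lemma walsh_bits_expn k u : walsh_bits (2 ^ k) u = (-1) ^+ u k.
Proof.
elim: k u => [|k ih] u; rewrite walsh_bits_rec.
  by rewrite expn0 /= walsh_bits0 mulr1.
by rewrite expnS mul2n odd_double doubleK ih/= expr0 mul1r.
Qed.

Lemma walsh_bits_low k r u : (forall m, (m < k)%N -> u m = false) ->
  (r < 2 ^ k)%N -> walsh_bits r u = 1.
Proof.
move=> uk rk; rewrite /walsh_bits big1// => m.
have [mk _|km] := ltnP m k; first by rewrite uk// expr0.
by rewrite divn_small// (leq_trans rk)// leq_exp2l.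
Qed.

Lemma walsh_bits_congr N j u v : (forall m, (m < N)%N -> u m = v m) ->
  (j < 2 ^ N)%N -> walsh_bits j u = walsh_bits j v.
Proof.
move=> uv jN; apply: eq_bigr => m; have [mN _|Nm] := ltnP m N; first by rewrite uv.
by rewrite divn_small// (leq_trans jN)// leq_exp2l.
Qed.

(* m is the position of the leading binary digit of j *)
Lemma walsh_bits_flip N j : (0 < j < 2 ^ N)%N -> exists2 m, (m < N)%N &
  forall u, walsh_bits j (fun k => u k (+) (k == m)) = - walsh_bits j u.
Proof.
move=> /andP[j0 jN]; exists (trunc_log 2 j).
  by rewrite -(@ltn_exp2l 2)// (leq_ltn_trans _ jN)// trunc_logP.
move=> u; rewrite walsh_bits_xor; set m := trunc_log 2 j.
have [m1 m2] : (2 ^ m <= j)%N /\ (j < 2 ^ m.+1)%N.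
  by rewrite trunc_logP//; split=> //; exact: trunc_log_ltn.
have -> : j = (1 * 2 ^ m + (j - 2 ^ m))%N by lia.
rewrite (@walsh_bitsD m 1 _ (fun k => k == m)); last by rewrite expnS in m2; lia.
rewrite mul1n walsh_bits_expn eqxx expr1.
rewrite (@walsh_bits_low m (j - 2 ^ m)) ?mulr1 ?mulrN1//.
  by move=> k km; apply/eqP; lia.
by rewrite expnS in m2; lia.
Qed.

(** * The Walsh-Dirichlet kernel away from the origin *)

Definition dirichlet m u : R := \sum_(j < m) walsh_bits j u.

Lemma dirichletS m u : dirichlet m.+1 u = dirichlet m u + walsh_bits m u.
Proof. by rewrite /dirichlet big_ord_recr. Qed.

Section first_digit.
Variables (s : nat) (u : nat -> bool).
Hypothesis us0 : forall m, (m < s)%N -> u m = false.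
Hypothesis us1 : u s.

(** The Walsh functions are 1 at u for indices below [2 ^ s] and -1 from there to [2 ^ s.+1]: the
    sums climb and descend with slope 1, a tent of height [2 ^ s]. *)
Lemma dirichlet_tri r : (r <= 2 ^ s.+1)%N ->
  dirichlet r u = (minn r (2 ^ s.+1 - r))%:R.
Proof.
elim: r => [|r ih] rs; first by rewrite /dirichlet big_ord0 min0n.
rewrite dirichletS ih ?(ltnW rs)//; rewrite expnS in rs *.
have [r2|r2] := ltnP r (2 ^ s).
  rewrite (walsh_bits_low us0 r2) natr1; congr (_%:R); lia.
have -> : walsh_bits r u = -1.
  have -> : r = (1 * 2 ^ s + (r - 2 ^ s))%N by lia.
  rewrite walsh_bitsD ?mul1n ?walsh_bits_expn ?us1; last by lia.
  by rewrite (walsh_bits_low us0) ?mulr1//; lia.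
rewrite (_ : minn r (2 * 2 ^ s - r) = (minn r.+1 (2 * 2 ^ s - r.+1)).+1); last by lia.
by rewrite -natr1 addrK.
Qed.

(** A complete block of [2 ^ s.+1] indices sums to the end value 0 of the tent, so only the
    incomplete last block contributes, up to the sign of its first Walsh function. *)
Lemma dirichletE q r : (r <= 2 ^ s.+1)%N ->
  dirichlet (q * 2 ^ s.+1 + r) u =
  walsh_bits (q * 2 ^ s.+1) u * (minn r (2 ^ s.+1 - r))%:R.
Proof.
move=> rs.
have block r' q' : (r' <= 2 ^ s.+1)%N -> dirichlet (q' * 2 ^ s.+1 + r') u =
    dirichlet (q' * 2 ^ s.+1) u +
    walsh_bits (q' * 2 ^ s.+1) u * (minn r' (2 ^ s.+1 - r'))%:R.
  move=> r's; rewrite -dirichlet_tri// /dirichlet big_split_ord/=; congr (_ + _).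
  rewrite mulr_sumr; apply: eq_bigr => i _; rewrite walsh_bitsD//.
  exact: leq_trans (ltn_ord i) r's.
have D0 q' : dirichlet (q' * 2 ^ s.+1) u = 0.
  elim: q' => [|q' ih]; first by rewrite mul0n /dirichlet big_ord0.
  by rewrite mulSn addnC block// ih subnn minn0 mulr0 addr0.
by rewrite block// D0 add0r.
Qed.

Lemma norm_dirichlet_le m : `|dirichlet m u| <= (2 ^ s)%:R.
Proof.
rewrite {1}(divn_eq m (2 ^ s.+1)) dirichletE; last by rewrite ltnW// ltn_pmod// expn_gt0.
by rewrite normrM norm_walsh_bits mul1r ger0_norm// ler_nat expnS; lia.
Qed.

End first_digit.

(** * Harmonic sums over dyadic blocks *)

Definition harmonic_sum m n : R := \sum_(m <= k < n) (k%:R)^-1.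

Lemma harmonic_sum_ge0 m n : 0 <= harmonic_sum m n.
Proof. by apply: sumr_ge0 => k _; rewrite invr_ge0. Qed.

Lemma harmonic_sumD m n p : (m <= n <= p)%N ->
  harmonic_sum m p = harmonic_sum m n + harmonic_sum n p.
Proof. by move=> /andP[mn np]; rewrite /harmonic_sum (big_cat_nat mn np). Qed.

Lemma harmonic_sum_block i :
  2^-1 <= harmonic_sum (2 ^ i) (2 ^ i.+1) <= 1.
Proof.
have c : (\sum_(2 ^ i <= k < 2 ^ i.+1) ((2 ^ i)%:R : R)^-1) = 1.
  rewrite sumr_const_nat expnS mul2n -addnn addnK.
  by rewrite -[LHS]mulr_natr mulVf// pnatr_eq0 expn_eq0.
apply/andP; split; last first.
  rewrite -c; apply: ler_sum_nat => k /andP[k1 k2].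
  by rewrite lef_pV2 ?posrE ?ltr0n ?expn_gt0 ?ler_nat//; apply: leq_trans k1; rewrite expn_gt0.
apply: (@le_trans _ _ (\sum_(2 ^ i <= k < 2 ^ i.+1) 2^-1 * ((2 ^ i)%:R)^-1)).
  by rewrite -mulr_sumr c mulr1.
apply: ler_sum_nat => k /andP[k1 k2].
have k0 : (0 < k)%N by apply: leq_trans k1; rewrite expn_gt0.
by rewrite -invfM -natrM lef_pV2 ?posrE ?ltr0n ?muln_gt0 ?expn_gt0// ler_nat -expnS ltnW.
Qed.

Lemma harmonic_sum_expn_le i j : harmonic_sum (2 ^ i) (2 ^ (i + j)) <= j%:R.
Proof.
elim: j => [|j ih]; first by rewrite addn0 /harmonic_sum big_geq.
rewrite (@harmonic_sumD _ (2 ^ (i + j))) ?leq_exp2l ?leq_addr ?leq_add2l ?leqnSn//.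
rewrite -natr1 lerD// addnS.
by have /andP[] := harmonic_sum_block (i + j).
Qed.

Lemma harmonic_sum_expn_ge i : i%:R / 2 <= harmonic_sum 1 (2 ^ i).
Proof.
elim: i => [|i ih]; first by rewrite mul0r /harmonic_sum big_geq.
rewrite (@harmonic_sumD _ (2 ^ i)); last by rewrite expn_gt0 leq_exp2l//=.
rewrite -natr1 mulrDl; apply: lerD => //; rewrite div1r.
by have /andP[] := harmonic_sum_block i.
Qed.

Lemma harmonic_sum_le m n p q : (m <= p)%N -> (q <= n)%N ->
  harmonic_sum p q <= harmonic_sum m n.
Proof.
move=> mp qn; have [pq|qp] := leqP p q; last first.
  by rewrite {1}/harmonic_sum big_geq ?harmonic_sum_ge0// ltnW.
rewrite (@harmonic_sumD m p n) ?mp ?(leq_trans pq)//.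
rewrite (@harmonic_sumD p q n) ?pq ?qn//.
by rewrite ler_wpDl ?harmonic_sum_ge0// ler_wpDr ?harmonic_sum_ge0.
Qed.

(** * Lower bound for the Noerlund logarithmic kernel *)

Definition norlund_kernel n u : R :=
  (harmonic_sum 1 n)^-1 * \sum_(1 <= k < n) dirichlet (n - k) u / k%:R.

(** For k < rho the index n - k stays in the last block, so these terms share one sign; for k <
    [2 ^ s] the tent is still at least [2 ^ s], because of the two bounds on rho. The terms with k
    >= rho are at most [2 ^ s.+1] times a harmonic sum over A dyadic blocks. *)
Lemma norlund_sum_ge n q rho A s u :
  (forall m, (m < s.+1)%N -> u m = false) -> u s.+1 ->
  n = (q * 2 ^ s.+2 + rho)%N -> (2 ^ s.+1 <= rho)%N -> (rho <= 3 * 2 ^ s)%N ->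
  (n <= 2 ^ (s.+1 + A))%N ->
  (2 ^ s)%:R * (s%:R / 2) - (2 ^ s.+1)%:R * A%:R <=
  `|\sum_(1 <= k < n) dirichlet (n - k) u / k%:R|.
Proof.
move=> us0 us1 nE rho1 rho2 nA.
have rho0 : (0 < rho)%N by apply: leq_trans rho1; rewrite expn_gt0.
have rhon : (rho <= n)%N by rewrite nE leq_addl.
rewrite (@big_cat_nat _ _ _ rho)//=.
set X := \sum_(1 <= k < rho) _; set Y := \sum_(rho <= k < n) _.
suff [hX hY] : (2 ^ s)%:R * (s%:R / 2) <= `|X| /\ `|Y| <= (2 ^ s.+1)%:R * A%:R.
  have := lerB_normD X Y; lra.
split.
- have -> : X = walsh_bits (q * 2 ^ s.+2) u *
      \sum_(1 <= k < rho) (minn (rho - k) (2 ^ s.+2 - (rho - k)))%:R / k%:R.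
    rewrite mulr_sumr; apply: eq_big_nat => k /andP[k1 k2].
    rewrite nE -addnBA ?(ltnW k2)// (dirichletE us0 us1) ?mulrA//.
    by rewrite expnS in rho1; rewrite !expnS; lia.
  rewrite normrM norm_walsh_bits mul1r ger0_norm; last first.
    by apply: sumr_ge0 => k _; rewrite divr_ge0.
  have le2 : (2 ^ s <= rho)%N by rewrite expnS in rho1; lia.
  rewrite (@big_cat_nat _ _ _ (2 ^ s)) ?expn_gt0//=.
  apply: ler_wpDr; first by apply: sumr_ge0 => k _; rewrite divr_ge0.
  apply: (@le_trans _ _ ((2 ^ s)%:R * harmonic_sum 1 (2 ^ s))).
    by rewrite ler_wpM2l// harmonic_sum_expn_ge.
  rewrite mulr_sumr; apply: ler_sum_nat => k /andP[k1 k2].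
  rewrite ler_wpM2r ?invr_ge0// ler_nat.
  by rewrite !expnS in rho1 *; lia.
- apply: le_trans (ler_norm_sum _ _ _) _.
  apply: (@le_trans _ _ ((2 ^ s.+1)%:R * harmonic_sum rho n)).
    rewrite mulr_sumr; apply: ler_sum => k _.
    rewrite normrM [`|_^-1|]ger0_norm ?invr_ge0// ler_wpM2r ?invr_ge0//.
    exact: norm_dirichlet_le.
  rewrite ler_wpM2l//; apply: le_trans (harmonic_sum_expn_le s.+1 A).
  exact: harmonic_sum_le.
Qed.

(** This is (4^a - 1) / 3, in binary 10...101. For every t < a its residue modulo 2 * 4^t is about
    two thirds of the modulus, near the peak of the tent of the shell 2t; hence one n serves all
    these shells. *)
Definition alternating_digits a : nat := \sum_(i < a) 4 ^ i.

Lemma alternating_digitsS a :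
  alternating_digits a.+1 = (alternating_digits a + 4 ^ a)%N.
Proof. by rewrite /alternating_digits big_ord_recr. Qed.

Lemma alternating_digits3 a : (3 * alternating_digits a).+1 = (4 ^ a)%N.
Proof.
elim: a => [|a ih]; first by rewrite /alternating_digits big_ord0.
by rewrite alternating_digitsS expnS; lia.
Qed.

Lemma alternating_digitsD a b :
  alternating_digits (a + b) = (alternating_digits a + 4 ^ a * alternating_digits b)%N.
Proof.
rewrite /alternating_digits big_split_ord/=; congr (_ + _)%N.
by rewrite big_distrr/=; apply: eq_bigr => i _; rewrite expnD.
Qed.

Lemma alternating_digits_ge a : (a <= alternating_digits a)%N.
Proof.
elim: a => // a ih; rewrite alternating_digitsS.
by have : (0 < 4 ^ a)%N by [rewrite expn_gt0]; lia.
Qed.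

(** With X = 4^t / 2 the main part is X (t - 1/2), the remainder at most 4 X (a - t), and the
    normalising sum at most 2a. For t >= 0.9 a the difference is at least X (a - 1) / 2, and a >= 10
    makes this at least the required 2a * 4^t / 10. *)
Lemma norlund_kernel_ge a t u :
  (9 * a <= 10 * t)%N -> (t < a)%N -> (10 <= a)%N ->
  (forall m, (m < t.*2)%N -> u m = false) -> u t.*2 ->
  (4 ^ t)%:R / 10 <= `|norlund_kernel (alternating_digits a) u|.
Proof.
move=> at1 at2 a10; case: t at1 at2 => [|t] at1 at2 us0 us1; first by lia.
set n := alternating_digits a; set s := t.*2.+1.
have ss : t.+1.*2 = s.+1 by lia.
rewrite ss in us0 us1.
have p4 k : (4 ^ k = 2 ^ k.*2)%N by rewrite -mul2n expnM.
(* [4 ^ t.+2] is [2 ^ s.+3], that is two periods [2 ^ s.+2]; hence the factor 2 in the quotient. *)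
have nE : n = ((2 * alternating_digits (a - t.+2)) * 2 ^ s.+2 + alternating_digits t.+2)%N.
  rewrite /n {1}(_ : a = (t.+2 + (a - t.+2))%N); last by lia.
  rewrite alternating_digitsD addnC; congr (_ + _)%N.
  rewrite p4 (_ : t.+2.*2 = s.+3); last by lia.
  by rewrite [in LHS]expnS; lia.
have q3 := alternating_digits3 a; have r3 := alternating_digits3 t.+2.
have e1 : (4 ^ a = 2 ^ a.*2)%N by exact: p4.
have e2 : (4 ^ t.+2 = 8 * 2 ^ s)%N.
  by rewrite p4 (_ : t.+2.*2 = s.+3) ?[in LHS]expnS ?expnS; lia.
have e3 : (4 ^ t.+1 = 2 * 2 ^ s)%N by rewrite p4 ss expnS.
have nA : (n <= 2 ^ (s.+1 + (a - t.+1).*2))%N.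
  by rewrite (_ : (s.+1 + (a - t.+1).*2)%N = a.*2); lia.
have rho1 : (2 ^ s.+1 <= alternating_digits t.+2)%N.
  by rewrite alternating_digitsS e3 expnS; lia.
have rho2 : (alternating_digits t.+2 <= 3 * 2 ^ s)%N by lia.
have := norlund_sum_ge us0 us1 nE rho1 rho2 nA.
rewrite /norlund_kernel normrM; set Z := `|\sum_(_ <= _ < _) _| => hZ.
have ln_gt0 : 0 < harmonic_sum 1 n.
  apply: (@lt_le_trans _ _ (harmonic_sum 1 2)).
    by rewrite /harmonic_sum big_nat1 invr1.
  by apply: harmonic_sum_le => //; apply: leq_trans (alternating_digits_ge a); lia.
have ln_le : harmonic_sum 1 n <= (a.*2)%:R.
  apply: le_trans (harmonic_sum_expn_le 0 a.*2).
  by apply: harmonic_sum_le => //; rewrite add0n; lia.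
rewrite normfV (gtr0_norm ln_gt0) ler_pdivlMl//.
apply: le_trans hZ.
apply: (@le_trans _ _ ((a.*2)%:R * ((4 ^ t.+1)%:R / 10))).
  by rewrite ler_wpM2r// divr_ge0.
rewrite e3 [(2 ^ s.+1)%N]expnS natrM.
have : (9 * a%:R : R) <= 10 * t.+1%:R by rewrite -!natrM ler_nat.
have : (10 : R) <= a%:R by rewrite ler_nat.
have -> : s%:R = 2 * t.+1%:R - 1 :> R.
  apply/eqP; rewrite eq_sym subr_eq natr1 -natrM eqr_nat; apply/eqP.
  by rewrite /s; lia.
have -> : ((a - t.+1).*2)%:R = 2 * (a%:R - t.+1%:R) :> R.
  by rewrite -muln2 natrM natrB ?(ltnW at2)// mulrC.
rewrite -muln2 natrM.
have : 0 < (2 ^ s)%:R :> R by rewrite ltr0n expn_gt0.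
move: (2 ^ s)%:R => X X0.
move: (a%:R : R) (t.+1%:R : R) => x y x10 xy.
have -> : x * 2 * (2 * X / 10) = X * (2 * x / 5) by field.
have -> : X * ((2 * y - 1) / 2) - 2 * X * (2 * (x - y)) =
  X * ((2 * y - 1) / 2 - 4 * (x - y)) by field.
by rewrite ler_pM2l//; lra.
Qed.

End walsh_on_bits.

(** * Random signs and translates on a finite set *)

Lemma bernoulli_expn (m e k : nat) :
  (m ^ k.+1 + k.+1 * e * m ^ k <= (m + e) ^ k.+1)%N.
Proof.
elim: k => [|k ih]; first by rewrite !expn1 expn0; lia.
rewrite [((m + e) ^ _)%N]expnS.
apply: leq_trans (leq_mul (leqnn (m + e)) ih).
rewrite [(m ^ k.+2)%N]expnS [(m ^ k.+1)%N]expnS.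
by move: (m ^ k)%N => x; nia.
Qed.

Section random_translates.
Context {R : realFieldType} {T : finType}.
Variables (ker : T -> T -> R) (lam : R) (K : nat).
Hypothesis T0 : (0 < #|T|)%N.
Hypothesis hK : forall x, (#|T| <= K * #|[set y | (lam <= `|ker x y|)%R]%SET|)%N.

Let Omega := {ffun 'I_K -> T * bool}.
Let val_at (w : Omega) x := \sum_k (-1) ^+ (w k).2 * ker x (w k).1.
Let good x : {set Omega} := [set w : Omega | lam <= `|val_at w x|]%SET.
Let hit x : {set Omega} := [set w : Omega | [exists k, lam <= `|ker x (w k).1|]]%SET.

(** K independent choices, each large with probability at least 1/K, all fail with probability at
    most (1 - 1/K)^K <= 1/2; [bernoulli_expn] is the division-free form of the last inequality. *)
Let card_hit x : (#|Omega| <= 2 * #|hit x|)%N.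
Proof.
set e := #|[set y | (lam <= `|ker x y|)%R]%SET|.
have K0 : (0 < K)%N by move: (hK x) T0; case: (K) => //; lia.
pose bad : pred (T * bool) := [pred p | ~~ (lam <= `|ker x p.1|)].
have cbad : #|bad| = ((#|T| - e) * 2)%N.
  rewrite (_ : #|bad| = #|finset.setX (~: [set y | (lam <= `|ker x y|)%R]) [set: bool]|%SET).
    by rewrite cardsX cardsT card_bool cardsCs finset.setCK.
  by apply: eq_card => -[y b]; rewrite !inE/= andbT.
have chitC : #|~: hit x| = (#|bad| ^ K)%N.
  rewrite -[X in (_ ^ X)%N]card_ord -card_ffun_on; apply: eq_card => w.
  rewrite !inE negb_exists; apply/forallP/ffun_onP => h k; have := h k; rewrite !inE//.
have cO : #|Omega| = ((#|T| * 2) ^ K)%N by rewrite card_ffun card_ord card_prod card_bool.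
have := cardsC (hit x); rewrite chitC cbad cO.
suff : (2 * ((#|T| - e) * 2) ^ K <= (#|T| * 2) ^ K)%N by lia.
rewrite !expnMn mulnA leq_mul2r; apply/orP; right.
have eT : (e <= #|T|)%N by exact: max_card.
have := hK x; rewrite -/e; case: (K) K0 => // k _ hk.
have := bernoulli_expn (#|T| - e) e k; rewrite subnK//.
apply: leq_trans; rewrite mul2n -addnn leq_add2l expnS leq_mul2r.
by apply/orP; right; lia.
Qed.

(** It depends on the translates and not on the signs, which makes [flip] an involution. *)
Let first_hit x (w : Omega) := [pick k | lam <= `|ker x (w k).1|].
Let flip x (w : Omega) : Omega :=
  [ffun k => ((w k).1, (w k).2 (+) (Some k == first_hit x w))].

Let first_hit_flip x w : first_hit x (flip x w) = first_hit x w.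
Proof. by apply: eq_pick => k; rewrite ffunE. Qed.

Let flipK x : involutive (flip x).
Proof.
move=> w; apply/ffunP => k; rewrite ffunE first_hit_flip ffunE/=.
by rewrite -addbA addbb addbF -surjective_pairing.
Qed.

(** If a is the first large term and A the rest of the sum, then (a + A) - (- a + A) = 2a, so a + A
    or - a + A is large: one of w and its flip is good. *)
Let card_good x : (#|hit x| <= 2 * #|good x|)%N.
Proof.
have -> : (2 * #|good x| = #|good x| + #|flip x @^-1: good x|)%N.
  by rewrite card_preimset ?mul2n ?addnn//; exact: (inv_inj (@flipK x)).
apply: leq_trans (leq_card_setU _ _); apply: subset_leq_card.
apply/fintype.subsetP => w; rewrite !inE => /existsP[k0 hk0].
case fh : (first_hit x w) => [k|]; last first.
  by move: fh; rewrite /first_hit; case: pickP => // /(_ k0); rewrite hk0.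
have hk : lam <= `|ker x (w k).1|.
  by move: fh; rewrite /first_hit; case: pickP => // k' ? [<-].
rewrite /val_at (bigD1 k)//= [in X in _ || X](bigD1 k)//=.
rewrite !ffunE fh eqxx/=.
have -> : \sum_(i < K | i != k) (-1) ^+ ((flip x w) i).2 * ker x ((flip x w) i).1 =
          \sum_(i < K | i != k) (-1) ^+ (w i).2 * ker x (w i).1.
  apply: eq_bigr => i ik; rewrite !ffunE fh/= (_ : (Some i == Some k) = false) ?addbF//.
  by apply/negbTE; apply: contra_neq ik => -[].
rewrite addbT; move: (\sum_(_ < _ | _) _) => A.
set a := ker x _ in hk *; case: (w k).2; rewrite /= ?expr0 ?expr1 ?mul1r ?mulN1r.
  have := ler_normB (a + A) (- a + A).
  rewrite (_ : a + A - (- a + A) = 2 * a); last by ring.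
  rewrite normrM ger0_norm//; case: (leP lam `|- a + A|) => //= h1.
  by case: (leP lam `|a + A|) => //= h2; lra.
have := ler_normB (a + A) (- a + A).
rewrite (_ : a + A - (- a + A) = 2 * a); last by ring.
rewrite normrM ger0_norm//; case: (leP lam `|- a + A|) => //= h1; rewrite ?orbT//.
by case: (leP lam `|a + A|) => //= h2; lra.
Qed.

(** A hit and then a favourable sign, each of probability 1/2, give probability 1/4 at every x;
    exchanging the sums over x and w produces one w that is good for a quarter of the points. *)
Lemma random_translates : exists (y : 'I_K -> T) (eps : 'I_K -> bool),
  (#|T| <= 4 * #|[set x | (lam <= `|\sum_k (-1) ^+ eps k * ker x (y k)|)%R]%SET|)%N.
Proof.
have good4 x : (#|Omega| <= 4 * #|good x|)%N.
  by have := card_hit x; have := card_good x; lia.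
suff [w hw] : exists w : Omega, (#|T| <= 4 * #|[set x | w \in good x]%SET|)%N.
  exists (fun k => (w k).1), (fun k => (w k).2); apply: leq_trans hw _.
  by rewrite leq_mul2l/=; apply: subset_leq_card; apply/fintype.subsetP => x; rewrite !inE.
apply/not_existsP => h.
have : (\sum_(w : Omega) 4 * #|[set x | w \in good x]%SET| < \sum_(w : Omega) #|T|)%N.
  have O0 : (0 < #|Omega|)%N by rewrite card_ffun card_prod card_bool expn_gt0 muln_gt0 T0.
  have /card_gt0P[w0 _] := O0.
  rewrite (bigD1 w0)//= [X in (_ < X)%N](bigD1 w0)//=.
  rewrite -addSn leq_add//; first by rewrite ltnNge; apply/negP/h.
  by apply: leq_sum => w _; rewrite leqNgt; apply/negP => /ltnW; exact: h.
rewrite sum_nat_const; apply/negP; rewrite -leqNgt.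
have -> : (\sum_(w : Omega) 4 * #|[set x | w \in good x]%SET| =
           \sum_(x : T) 4 * #|good x|)%N.
  rewrite -!big_distrr/=; congr (_ * _)%N.
  under eq_bigr do rewrite -sum1dep_card big_mkcond.
  by rewrite exchange_big; apply: eq_bigr => x _; rewrite -sum1_card [RHS]big_mkcond.
rewrite mulnC -sum_nat_const; apply: leq_sum => x _; exact: good4.
Qed.

End random_translates.

(** * Binary digits of reals and dyadic intervals *)

Section binary_digits.
Context {R : realType}.
Implicit Types (x : R) (m N : nat).

Definition bit x m : bool := ~~ (2 ^+ m * x - (Num.floor (2 ^+ m * x))%:~R < 2^-1).

Lemma rademacherE m x : rademacher m x = (-1) ^+ bit x m.
Proof. by rewrite /rademacher /rademacher0 /bit; case: ifP. Qed.

Lemma walshE j x : walsh j x = walsh_bits j (bit x).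
Proof. by apply: eq_bigr => m _; rewrite rademacherE. Qed.

(** The position k is left existential: only measurability and the length of the interval are
    used. *)
Lemma dyadic_interval N (v : nat -> bool) : exists k : nat,
  [set x : R | `[0, 1[%classic x /\ forall m, (m < N)%N -> bit x m = v m] =
  `[k%:R / 2 ^+ N, k.+1%:R / 2 ^+ N[%classic.
Proof.
elim: N => [|N [k ih]].
  exists 0%N; rewrite expr0 mul0r divr1.
  by apply/seteqP; split=> [x [x01 _]//|x x01]; split.
exists (k.*2 + v N)%N.
have p0 : 0 < 2 ^+ N :> R by rewrite exprn_gt0.
have -> : [set x : R | `[0, 1[%classic x /\ forall m, (m < N.+1)%N -> bit x m = v m] =
    `[k%:R / 2 ^+ N, k.+1%:R / 2 ^+ N[%classic `&` [set x | bit x N = v N].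
  rewrite -ih; apply/seteqP; split=> x /= [].
    by move=> x01 xv; split; [split=> // m mN; apply: xv; exact: ltnW|exact: xv].
  by move=> [x01 xv] xN; split=> // m; rewrite ltnS leq_eqVlt => /orP[/eqP->//|]; exact: xv.
have E x : (x \in `[k%:R / 2 ^+ N, k.+1%:R / 2 ^+ N[) = (k%:R <= 2 ^+ N * x < k%:R + 1).
  by rewrite in_itv/= ler_pdivrMr// ltr_pdivlMr// mulrC natr1.
have kN b : (k.*2 + b)%:R / 2 ^+ N.+1 = (k%:R + b%:R / 2) / 2 ^+ N :> R.
  rewrite exprS natrD -muln2 natrM; field.
  by rewrite lt0r_neq0.
have E2 b x : (x \in `[(k.*2 + b)%:R / 2 ^+ N.+1, (k.*2 + b).+1%:R / 2 ^+ N.+1[) =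
   (k%:R + b%:R / 2 <= 2 ^+ N * x < k%:R + (b.+1)%:R / 2).
  by rewrite -addnS !kN in_itv/= ler_pdivrMr// ltr_pdivlMr// [x * _]mulrC.
apply/seteqP; split=> x /=; rewrite E2.
  move=> [+ xN]; rewrite E => /andP[x1 x2].
  move: xN; rewrite /bit (@floor_def _ _ k); last by rewrite intrD -!pmulrn x1 x2.
  rewrite -pmulrn; case: (v N) => /=; last first.
    move/negbFE => h; apply/andP; split; lra.
  by rewrite -leNgt => h; apply/andP; split; lra.
move=> /andP[x1 x2].
have h : k%:R <= 2 ^+ N * x < k%:R + 1 by apply/andP; case: (v N) x1 x2 => /= x1 x2; split; lra.
split; first by rewrite E.
rewrite /bit (@floor_def _ _ k); last by rewrite intrD -!pmulrn.
rewrite -pmulrn; case: (v N) x1 x2 => /= x1 x2; last by apply/negbF; lra.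
by rewrite -leNgt; lra.
Qed.

Definition dyadic_piece N (v : nat -> bool) : set (measurableTypeR R) :=
  [set x : R | `[0, 1[%classic x /\ forall m, (m < N)%N -> bit x m = v m].

Lemma measurable_dyadic_piece N v : measurable (dyadic_piece N v).
Proof. by rewrite /dyadic_piece; have [k ->] := dyadic_interval N v; exact: measurable_itv. Qed.

Lemma lebesgue_dyadic_piece N v :
  lebesgue_measure (dyadic_piece N v) = ((2 ^+ N)^-1)%:E.
Proof.
rewrite /dyadic_piece; have [k ->] := dyadic_interval N v.
rewrite lebesgue_measure_itv/= lte_fin ltr_pM2r ?invr_gt0 ?exprn_gt0// ltr_nat ltnSn.
by rewrite -EFinB -mulrBl -natr1 addrAC subrr add0r mul1r.
Qed.

End binary_digits.

(** * Dyadic cells of the cube and step functions *)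

Section cells.
Context {R : realType} (d N : nat).
Notation cube := (unit_cube R d).
Notation mu := (lebesgue_tuple R d).
Notation word := {ffun 'I_N -> bool}.
Notation cells := {ffun 'I_d -> word}.

(** Walsh functions of index below [2 ^ N] do not see the padding by [false]. *)
Definition digits (v : word) (m : nat) : bool := oapp v false (insub m).

Lemma digitsE (v : word) (m : 'I_N) : digits v m = v m.
Proof. by rewrite /digits valK. Qed.

Definition cell (x : d.-tuple (measurableTypeR R)) : cells :=
  [ffun i => [ffun m : 'I_N => bit (tnth x i : R) m]].

Definition cell_set (c : cells) := cube `&` [set x | cell x = c].

Lemma digits_cell x i m : (m < N)%N -> digits (cell x i) m = bit (tnth x i : R) m.
Proof. by move=> mN; rewrite -[m]/(nat_of_ord (Ordinal mN)) digitsE !ffunE. Qed.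

Lemma cell_setE c : cell_set c =
  [set x | forall i, dyadic_piece N (digits (c i)) (tnth x i)].
Proof.
apply/seteqP; split=> x /=.
  by move=> [x01 xc] i; split=> [|m mN]; [exact: x01|rewrite -digits_cell// xc].
move=> h; split; first by move=> i; have [] := h i.
apply/ffunP => i; apply/ffunP => m; rewrite !ffunE.
by have [_ ->//] := h i; rewrite digitsE.
Qed.

Lemma measurable_cell_set c : measurable (cell_set c).
Proof.
rewrite cell_setE.
exact: (measurable_box (fun i => measurable_dyadic_piece N (digits (c i)))).
Qed.

Lemma lebesgue_cell_set c : mu (cell_set c) = (((2 ^+ N)^-1) ^+ d)%:E.
Proof.
rewrite cell_setE.
rewrite (lebesgue_tuple_box (fun i => measurable_dyadic_piece N (digits (c i)))).
under eq_bigr do rewrite lebesgue_dyadic_piece.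
by rewrite prodEFin prodr_const card_ord.
Qed.

Lemma measurable_unit_cube : measurable cube.
Proof. by apply: (@measurable_box R d (fun=> `[0, 1[%classic)) => i; exact: measurable_itv. Qed.

Lemma lebesgue_unit_cube : mu cube = 1%E.
Proof.
rewrite /unit_cube (@lebesgue_tuple_box R d (fun=> `[0, 1[%classic)) => [|i]; last exact: measurable_itv.
by under eq_bigr do rewrite lebesgue_measure_itv/= lte01 oppr0 adde0; rewrite big1.
Qed.

Lemma integrable_unit_cube (f : d.-tuple (measurableTypeR R) -> R) :
  measurable_fun cube f -> (exists C, forall x, `|f x| <= C) ->
  mu.-integrable cube (EFin \o f).
Proof.
move=> mf [C fC]; apply: measurable_bounded_integrable => //.
- exact: measurable_unit_cube.
- by rewrite [X in (X < _)%E](lebesgue_unit_cube) ltry.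
- exists C; split; first exact: num_real.
  by move=> M CM x _; apply: le_trans (fC x) _; exact: ltW.
Qed.

Lemma measurable_fun_cell d' (T : measurableType d') (F : cells -> T) :
  measurable_fun cube (F \o cell).
Proof.
move=> mD Y mY.
have -> : cube `&` (F \o cell) @^-1` Y = \bigcup_(c in [set c | Y (F c)]) cell_set c.
  apply/seteqP; split=> x /=; first by move=> [x01 Yx]; exists (cell x).
  by move=> [c Yc [x01 xc]]; rewrite -xc in Yc.
by apply: fin_bigcup_measurable => // c _; exact: measurable_cell_set.
Qed.

Lemma integral_cell (F : cells -> R) :
  (\int[mu]_(x in cube) (F (cell x))%:E = (((2 ^+ N)^-1) ^+ d * \sum_c F c)%:E)%E.
Proof.
rewrite (eq_integral (fun x => \sum_(c : cells) ((F c)%:E * (\1_(cell_set c) x)%:E))%E); last first.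
  move=> x; rewrite inE => x01.
  rewrite (bigD1 (cell x))//= indicE mem_set// mule1 big1 ?adde0// => c xc.
  rewrite indicE memNset ?mule0//; apply: contraTnot xc => -[_ /= ->].
  by rewrite eqxx.
have mC := measurable_unit_cube.
have ii c : mu.-integrable cube (fun x => (\1_(cell_set c) x)%:E).
  apply: integrable_unit_cube; first exact: measurable_indic (measurable_cell_set c).
  by exists 1 => x; rewrite indicE; case: (_ \in _); rewrite ?normr1 ?normr0.
rewrite integral_sum//; last by move=> c; exact: integrableZl.
rewrite mulr_sumr -sumEFin; apply: eq_bigr => c _.
rewrite integralZl// integral_indic//; last exact: measurable_cell_set.
rewrite setIidl; last by move=> x [].
by rewrite [X in (_ * X)%E]lebesgue_cell_set -EFinM mulrC.
Qed.

Lemma lebesgue_cell_pred (P : pred cells) :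
  mu (cube `&` [set x | P (cell x)]) = (((2 ^+ N)^-1) ^+ d * #|P|%:R)%:E.
Proof.
have mP : measurable (cube `&` [set x | P (cell x)]).
  exact: (@measurable_fun_cell _ _ P measurable_unit_cube [set true]).
have := @integral_indic _ _ _ mu cube measurable_unit_cube _ mP.
rewrite setIAC setIid => <-.
rewrite (eq_integral (fun x => ((P (cell x))%:R : R)%:E)).
  rewrite (integral_cell (fun c => (P c)%:R)) -natr_sum -sum1_card [in RHS]big_mkcond/=.
  by congr ((_ * _%:R)%:E); apply: eq_bigr => c _; rewrite unfold_in; case: (P c).
move=> x; rewrite inE => x01; rewrite indicE; congr (_%:R%:E).
by case h : (P (cell x)); [rewrite mem_set|rewrite memNset//= => -[]; rewrite /= h].
Qed.

End cells.

(** * Sums over boxes of multi-indices *)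

Section box_sum_theory.
Context {d : nat}.
Implicit Types (a : nat) (b : 'I_d -> nat).

Lemma eq_box_sum (V : nmodType) a b (F G : ('I_d -> nat) -> V) :
  (forall j, (forall i, (a <= j i < b i)%N) -> F j = G j) ->
  box_sum a b F = box_sum a b G.
Proof. by move=> FG; apply: eq_bigr => j /forallP h; exact: FG. Qed.

Lemma box_sum_prod (R : comPzRingType) a b (g : 'I_d -> nat -> R) :
  box_sum a b (fun j => \prod_i g i (j i)) = \prod_i \sum_(a <= k < b i) g i k.
Proof.
rewrite /box_sum; set M := \max_(i < d) b i.
have bM i : (b i <= M)%N by exact: leq_bigmax.
transitivity (\prod_i \sum_(k < M | (a <= k < b i)%N) g i k); last first.
  apply: eq_bigr => i _.
  rewrite big_geq_mkord (big_ord_widen_cond M (fun k => (a <= k)%N) (fun k => g i k) (bM i)).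
  by apply: eq_bigl => k.
rewrite bigA_distr_big_dep/=; apply: eq_bigl => j.
by apply/forallP/familyP => h i; have := h i.
Qed.

Lemma norm_box_sum_le (R : numDomainType) a b (F : ('I_d -> nat) -> R) (G : ('I_d -> nat) -> R) :
  (forall j, `|F j| <= G j) -> `|box_sum a b F| <= box_sum a b G.
Proof. by move=> FG; apply: le_trans (ler_norm_sum _ _ _) _; exact: ler_sum. Qed.

Lemma box_sum_ge0 (R : numDomainType) a b (F : ('I_d -> nat) -> R) :
  (forall j, 0 <= F j) -> 0 <= box_sum a b F.
Proof. by move=> F0; exact: sumr_ge0. Qed.

End box_sum_theory.

(** * The means as functionals of the coefficients *)

Section log_mean_of_coefficients.
Context {R : realType} {d : nat} (B : {set 'I_d}).
Notation point := (d.-tuple (measurableTypeR R)).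
Implicit Types (n : 'I_d -> nat) (c : ('I_d -> nat) -> R) (x : point).

(** Depending on the coefficient family alone, it is linear without any integrability condition, and
    coefficients may be replaced freely. *)
Definition log_mean_coef n c x : R :=
  (\prod_(j < d) log_norm R (n j))^-1 *
  box_sum 1 n (fun i =>
    box_sum 0 (fun j => if j \in B then (n j - i j)%N else i j)
      (fun j => c j * mwalsh j x)
    / \prod_(j < d) (i j)%:R).

Lemma mixed_log_meanE n (f : point -> R) x :
  mixed_log_mean B n f x = log_mean_coef n (walsh_coef f) x.
Proof. by []. Qed.

Lemma norm_mwalsh (j : 'I_d -> nat) x : `|mwalsh j x| = 1.
Proof. by rewrite normr_prod big1// => i _; rewrite walshE norm_walsh_bits. Qed.

Lemma log_mean_coefD n c1 c2 x :
  log_mean_coef n (fun j => c1 j + c2 j) x = log_mean_coef n c1 x + log_mean_coef n c2 x.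
Proof.
rewrite -mulrDr; congr (_ * _); rewrite -big_split/=; apply: eq_bigr => i _.
rewrite -mulrDl; congr (_ / _); rewrite -big_split/=; apply: eq_bigr => j _.
by rewrite mulrDl.
Qed.

Lemma log_mean_coefZ n a c x :
  log_mean_coef n (fun j => a * c j) x = a * log_mean_coef n c x.
Proof.
rewrite /log_mean_coef mulrCA; congr (_ * _); rewrite mulr_sumr; apply: eq_bigr => i _.
rewrite mulrA; congr (_ / _); rewrite mulr_sumr; apply: eq_bigr => j _.
by rewrite mulrA.
Qed.

Lemma log_mean_coef0 n x : log_mean_coef n (fun=> 0) x = 0.
Proof.
rewrite -[RHS](mul0r (log_mean_coef n (fun=> 0) x)) -log_mean_coefZ.
by congr log_mean_coef; apply/funext => j; rewrite mulr0.
Qed.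

Lemma log_mean_coef_sum (I : Type) (s : seq I) n (a : I -> R)
    (c : I -> ('I_d -> nat) -> R) x :
  log_mean_coef n (fun j => \sum_(k <- s) a k * c k j) x =
  \sum_(k <- s) a k * log_mean_coef n (c k) x.
Proof.
elim: s => [|k s ih].
  by rewrite big_nil -[RHS](log_mean_coef0 n x); congr log_mean_coef; apply/funext => j; rewrite big_nil.
rewrite big_cons -ih -log_mean_coefZ -log_mean_coefD; congr log_mean_coef.
by apply/funext => j; rewrite big_cons.
Qed.

(** A crude constant depending on n is enough: the gliding hump fixes n before it chooses the size
    of the later terms. *)
Lemma log_mean_coef_bound n : exists2 C : R, 0 < C & forall c e x,
  (forall j, `|c j| <= e) -> `|log_mean_coef n c x| <= C * e.
Proof.
pose C := `|(\prod_(j < d) log_norm R (n j))^-1| *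
  box_sum 1 n (fun i =>
    box_sum 0 (fun j => if j \in B then (n j - i j)%N else i j) (fun j => 1)
    / \prod_(j < d) (i j)%:R).
have C0 : 0 <= C.
  apply: mulr_ge0 => //; apply: box_sum_ge0 => i; apply: divr_ge0.
    by apply: box_sum_ge0 => j.
  by apply: prodr_ge0.
(* [C] vanishes when some [n j] is at most 1, while the constant is inverted later. *)
exists (C + 1); first by rewrite ltr_wpDl.
move=> c e x ce; have e0 : 0 <= e by apply: le_trans (ce (fun=> 0%N)).
apply: (@le_trans _ _ (C * e)); last by rewrite ler_wpM2r// lerDl.
rewrite normrM /C -mulrA ler_wpM2l// mulr_suml.
apply: (@norm_box_sum_le _ _ _ _ _ (fun i => box_sum 0 (fun j => if j \in B then (n j - i j)%N else i j) (fun j => 1)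
    / \prod_(j < d) (i j)%:R * e)) => i.
rewrite normrM normfV normr_prod.
under eq_bigr do rewrite normr_nat.
rewrite mulrAC ler_wpM2r ?invr_ge0 ?prodr_ge0// mulr_suml.
apply: (@norm_box_sum_le _ _ _ _ _ (fun=> 1 * e)) => j.
by rewrite normrM norm_mwalsh mulr1 mul1r.
Qed.

(** For 1 <= i < n both n - i and i are below n, so no partial sum in the mean reaches the index
    n. *)
Lemma eq_log_mean_coef n c1 c2 x :
  (forall j, (forall i, (j i < n i)%N) -> c1 j = c2 j) ->
  log_mean_coef n c1 x = log_mean_coef n c2 x.
Proof.
move=> c12; congr (_ * _); apply: eq_box_sum => i hi; congr (_ / _).
apply: eq_box_sum => j hj; rewrite c12// => k.
by move: (hi k) (hj k); case: ifP => _; lia.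
Qed.

Lemma log_mean_coef_prod n (g : 'I_d -> nat -> R) x :
  log_mean_coef n (fun j => \prod_i g i (j i)) x =
  \prod_i ((log_norm R (n i))^-1 * \sum_(1 <= k < n i)
    (\sum_(0 <= m < if i \in B then (n i - k)%N else k)
      g i m * walsh m (tnth x i : R)) / k%:R).
Proof.
rewrite /log_mean_coef [RHS]big_split/= prodfV; congr (_ * _).
rewrite -(box_sum_prod 1 n (fun i k =>
  (\sum_(0 <= m < if i \in B then (n i - k)%N else k)
      g i m * walsh m (tnth x i : R)) / k%:R)).
apply: eq_box_sum => i _; rewrite [RHS]big_split/= prodfV; congr (_ * _).
rewrite -(box_sum_prod 0 _ (fun i m => g i m * walsh m (tnth x i : R))).
apply: eq_box_sum => j _.
by rewrite /mwalsh -big_split.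
Qed.

End log_mean_of_coefficients.

(** * Means of step functions and of bumps *)

Section log_mean_step.
Context {R : realType} {d : nat} (B : {set 'I_d}) (N n : nat).
Hypotheses (nN : (n <= 2 ^ N)%N) (n2 : (2 <= n)%N).
Notation point := (d.-tuple (measurableTypeR R)).
Notation word := {ffun 'I_N -> bool}.
Notation cells := {ffun 'I_d -> word}.

Lemma mwalsh_cell (j : 'I_d -> nat) (x : point) : (forall i, (j i < 2 ^ N)%N) ->
  mwalsh j x = \prod_i walsh_bits (j i) (digits (cell N x i)).
Proof.
move=> jN; apply: eq_bigr => i _; rewrite walshE; apply: walsh_bits_congr (jN i) => m mN.
by rewrite digits_cell.
Qed.

Definition cell_coef (F : cells -> R) (j : 'I_d -> nat) : R :=
  ((2 ^+ N)^-1) ^+ d * \sum_c F c * \prod_i walsh_bits (j i) (digits (c i)).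

Lemma walsh_coef_cell (F : cells -> R) (j : 'I_d -> nat) :
  (forall i, (j i < 2 ^ N)%N) ->
  walsh_coef (F \o cell N) j = cell_coef F j.
Proof.
move=> jN; rewrite /walsh_coef /Rintegral.
rewrite (eq_integral (fun x => ((F (cell N x) *
  \prod_i walsh_bits (j i) (digits (cell N x i)))%:E))); last first.
  by move=> x _ /=; rewrite mwalsh_cell.
by rewrite (integral_cell (fun c => F c * \prod_i walsh_bits (j i) (digits (c i)))).
Qed.

Lemma mixed_log_mean_cell (F : cells -> R) (x : point) :
  mixed_log_mean B (fun=> n) (F \o cell N) x = log_mean_coef B (fun=> n) (cell_coef F) x.
Proof.
rewrite mixed_log_meanE; apply: eq_log_mean_coef => j jn; apply: walsh_coef_cell => i.
exact: leq_trans (jn i) nN.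
Qed.

(** Flipping, in every word, the digit at the position of the leading digit of m permutes the words
    and negates each term, so for m > 0 the sum equals its own negative. *)
Lemma sum_walsh_bits m : (m < 2 ^ N)%N ->
  (2 ^+ N)^-1 * \sum_(v : word) walsh_bits m (digits v) = (m == 0%N)%:R :> R.
Proof.
have [->|m0 mN] := eqVneq m 0%N.
  move=> _; under eq_bigr do rewrite walsh_bits0.
  rewrite sumr_const card_ffun card_bool card_ord -mulr_natr mul1r.
  by rewrite natrX mulVf// expf_neq0.
have [|k kN hk] := @walsh_bits_flip R N m; first by rewrite lt0n m0.
pose fl (v : word) : word := [ffun i => v i (+) (i == k :> nat)].
have flK : involutive fl.
  by move=> v; apply/ffunP => i; rewrite !ffunE -addbA addbb addbF.
set S := \sum_v _; suff : S = - S by move=> h; rewrite (_ : S = 0) ?mulr0//; lra.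
rewrite {1}/S (reindex_inj (inv_inj flK))/= -sumrN; apply: eq_bigr => v _.
rewrite -hk; apply: walsh_bits_congr mN => i iN.
by rewrite -[i]/(nat_of_ord (Ordinal iN)) !digitsE ffunE.
Qed.

(** In the variables of B it acts as a Dirac mass at y on all Walsh functions of index below
    [2 ^ N]; in the others it is constant. *)
Definition bump (y c : cells) : R := \prod_(i in B) (2 ^+ N * (c i == y i)%:R).

Lemma cell_coef_bump y (j : 'I_d -> nat) : (forall i, (j i < 2 ^ N)%N) ->
  cell_coef (bump y) j = \prod_i
    (if i \in B then walsh_bits (j i) (digits (y i)) else (j i == 0%N)%:R).
Proof.
move=> jN; rewrite /cell_coef.
have -> : (2 ^+ N)^-1 ^+ d = \prod_(i < d) (2 ^+ N)^-1 :> R by rewrite prodr_const card_ord.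
under [X in _ * X]eq_bigr do rewrite /bump big_mkcond -big_split/=.
rewrite -(bigA_distr_bigA (fun i (v : word) =>
  (if i \in B then 2 ^+ N * (v == y i)%:R else 1) * walsh_bits (j i) (digits v))).
rewrite -big_split/=; apply: eq_bigr => i _; case: ifPn => iB; last first.
  by under eq_bigr do rewrite mul1r; rewrite sum_walsh_bits.
rewrite (bigD1 (y i))//= eqxx mulr1 big1 ?addr0 ?mulKf ?expf_neq0// => v vy.
by rewrite (negbTE vy) mulr0 mul0r.
Qed.

Definition bump_kernel (c y : cells) : R :=
  \prod_(i in B) norlund_kernel n (fun m => digits (y i) m (+) digits (c i) m).

(** In a variable of B the terms w_m(y) w_m(x) are w_m of the dyadic sum, which gives the Noerlund
    kernel. In the others each partial sum of the constant 1 has at least one term, equals 1, and so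
    does its Riesz mean. *)
Lemma log_mean_bump y (x : point) :
  log_mean_coef B (fun=> n) (cell_coef (bump y)) x = bump_kernel (cell N x) y.
Proof.
rewrite (@eq_log_mean_coef _ _ _ _ _ (fun j => \prod_i
    (if i \in B then walsh_bits (j i) (digits (y i)) else (j i == 0%N)%:R))); last first.
  by move=> j jn; apply: cell_coef_bump => i; exact: leq_trans (jn i) nN.
rewrite (@log_mean_coef_prod _ _ _ _ (fun i m =>
  if i \in B then walsh_bits m (digits (y i)) else (m == 0%N)%:R)).
rewrite /bump_kernel [RHS]big_mkcond/=; apply: eq_bigr => i _.
have ln0 : 0 < log_norm R n.
  rewrite /log_norm big_ltn// invr1 ltr_wpDr//.
  by apply: sumr_ge0 => k _; rewrite invr_ge0.
case: ifPn => iB.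
  congr (_ * _); apply: eq_big_nat => k /andP[k1 k2]; congr (_ / _).
  rewrite big_mkord; apply: eq_bigr => m _.
  rewrite walsh_bits_xor walshE; congr (_ * _).
  apply: (@walsh_bits_congr _ N) => [l lN|]; first by rewrite digits_cell.
  by apply: leq_trans nN; have := ltn_ord m; lia.
rewrite (_ : \sum_(1 <= k < n) _ = log_norm R n) ?mulVf ?lt0r_neq0//.
apply: eq_big_nat => k /andP[k1 k2].
rewrite big_ltn// eqxx mul1r walsh0 big1_seq ?addr0 ?mul1r// => m /andP[_].
by rewrite mem_index_iota => /andP[m1 _]; rewrite (_ : (m == 0%N) = false) ?mul0r//; lia.
Qed.

End log_mean_step.

(** * Dyadic shells *)

Section shells.
Variable N : nat.
Notation word := {ffun 'I_N -> bool}.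

(** For s < N, the words of the points in [2^(-s-1), 2^(-s)). *)
Definition shell (s : nat) : {set word} :=
  [set v : word | [forall m : 'I_N, if (m < s)%N then ~~ v m else (m == s :> nat) ==> v m]]%SET.

Lemma shellP s (v : word) : (s < N)%N -> v \in shell s ->
  (forall m, (m < s)%N -> digits v m = false) /\ digits v s.
Proof.
move=> sN; rewrite inE => /forallP h; split=> [m ms|].
  have mN := ltn_trans ms sN.
  rewrite -[m]/(nat_of_ord (Ordinal mN)) digitsE.
  by have := h (Ordinal mN); rewrite /= ms => /negbTE.
have := h (Ordinal sN); rewrite /= ltnn eqxx/= => h'.
by rewrite -[s]/(nat_of_ord (Ordinal sN)) digitsE.
Qed.

Lemma shell_inj s s' (v : word) : (s < N)%N -> (s' < N)%N ->
  v \in shell s -> v \in shell s' -> s = s'.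
Proof.
move=> sN s'N /(shellP sN)[h1 h2] /(shellP s'N)[h1' h2'].
case: (ltngtP s s') => // ss.
- by move: (h1' _ ss); rewrite h2.
- by move: (h1 _ ss); rewrite h2'.
Qed.

Lemma card_shell s : (s < N)%N -> (#|shell s| * 2 ^ s.+1 = 2 ^ N)%N.
Proof.
move=> sN.
pose F (m : 'I_N) : pred bool :=
  [pred b | if (m < s)%N then ~~ b else (m == s :> nat) ==> b].
have -> : #|shell s| = #|family F|.
  by apply: eq_card => v; rewrite inE; apply/forallP/familyP => h m; have := h m.
have -> : #|family F| = (\prod_(m < N) if (m <= s)%N then 1 else 2)%N.
  rewrite card_family foldrE big_map big_enum/=; apply: eq_bigr => m _.
  have -> : (#|F m| = F m true + F m false)%N.
    move: (F m) => p; rewrite -sum1_card big_mkcond big_bool/= !unfold_in.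
    by case: (p true); case: (p false).
  rewrite /F/=; case: ltngtP => //.
rewrite -(big_mkord predT (fun m => if (m <= s)%N then 1%N else 2)).
rewrite (@big_cat_nat _ _ _ s.+1)//= big_nat_cond big1 ?mul1n; last first.
  by move=> m /andP[/andP[_ +] _]; rewrite ltnS => ->.
rewrite big_nat_cond (eq_bigr (fun=> 2%N)); last first.
  by move=> m /andP[/andP[+ _] _]; rewrite ltnNge => /negbTE ->.
by rewrite -big_nat_cond prod_nat_const_nat -expnD subnK.
Qed.

End shells.

(** * Counting the cells where the product kernel is large *)

Section large_kernel.
Context {R : realType} {d : nat} (B : {set 'I_d}) (w : nat).
Hypotheses (B2 : (1 < #|B|)%N) (w1 : (0 < w)%N).
Notation b := #|B|.

(** This is the a of the one-dimensional estimate. All depths used below lie between 9 b w and 9 b w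
    + (b - 1) w, inside the window from 0.9 a to a; w measures the freedom of each non-pivot
    depth. *)
Definition hump_terms := (10 * b * w)%N.
Definition hump_level := hump_terms.*2.
Definition hump_order := alternating_digits hump_terms.
Definition hump_depth := (b * (9 * b * w) + b.-1 * w)%N.
Definition hump_height : R := (4 ^ hump_depth)%:R / 10 ^+ b.

Notation N := hump_level.
Notation word := {ffun 'I_N -> bool}.
Notation cells := {ffun 'I_d -> word}.
Notation slack := {ffun 'I_d -> 'I_w.+1}.

Section with_pivot.
Variable i0 : 'I_d.
Hypothesis i0B : i0 \in B.

(* The pivot absorbs the choices made in the other variables, so that the sum of
   the depths does not depend on t. *)
Let depth (t : slack) (i : 'I_d) : nat := (9 * b * w +
  if i == i0 then \sum_(j in B | j != i0) (w - t j) else t i)%N.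

Let depth_lt t i : i \in B -> (depth t i < hump_terms)%N.
Proof.
move=> iB; rewrite /depth /hump_terms.
suff : ((if i == i0 then \sum_(j in B | j != i0) (w - t j) else t i) <= b.-1 * w)%N.
  move: (if _ then _ else _) => X Xb.
  have bw : (b * w = b.-1 * w + w)%N by rewrite -mulSnr prednK// ltnW.
  rewrite -!mulnA bw; move: Xb (w1); move: (b.-1 * w)%N => Y; lia.
case: ifP => _.
  rewrite (cardD1 i0) i0B add1n /= -sum_nat_const.
  rewrite (eq_bigl (fun j => j \in [predD1 B & i0])); last by move=> j; rewrite !inE andbC.
  by apply: leq_sum => j _; exact: leq_subr.
have := ltn_ord (t i); rewrite ltnS => /leq_trans; apply.
by apply: leq_pmull; case: (b) B2 => // -[].
Qed.

Let sum_depth t : (\sum_(i in B) depth t i = hump_depth)%N.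
Proof.
rewrite big_split/= sum_nat_const; congr (_ + _)%N.
rewrite (bigD1 i0)//= eqxx [X in (_ + X)%N](eq_bigr (fun i => t i : nat)); last first.
  by move=> i /andP[_ /negbTE ->].
rewrite -big_split/= (eq_bigr (fun=> w)); last by move=> i _; rewrite subnK// -ltnS.
rewrite sum_nat_const; congr (_ * _)%N; rewrite [in RHS](cardD1 i0) i0B add1n/=.
by apply: eq_card => j; rewrite !inE andbC.
Qed.

Let pieces (t : slack) : {set cells} :=
  [set z : cells | [forall (i | i \in B), z i \in shell N (depth t i).*2]]%SET.

(** The shell of depth t has relative measure 2^(-2t-1). Since the depths have a constant sum, all
    pieces have the same size. *)
Let card_pieces t : (#|pieces t| * 2 ^ (hump_depth.*2 + b) = 2 ^ (N * d))%N.
Proof.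
pose F (i : 'I_d) : pred word := [pred v | (i \in B) ==> (v \in shell N (depth t i).*2)].
have -> : #|pieces t| = #|family F|.
  by apply: eq_card => z; rewrite inE; apply/forallP/familyP => h i; have := h i.
have -> : (2 ^ (hump_depth.*2 + b) = \prod_(i < d) if i \in B then 2 ^ ((depth t i).*2.+1) else 1)%N.
  rewrite -big_mkcond/= -expn_sum; congr (_ ^ _)%N.
  under eq_bigr do rewrite -addn1.
  rewrite big_split/= sum1_card -(sum_depth t); congr (_ + _)%N.
  by rewrite -mul2n big_distrr/=; apply: eq_bigr => i _; rewrite mul2n.
rewrite card_family foldrE big_map big_enum/= -big_split/=.
have -> : (2 ^ (N * d) = \prod_(i < d) 2 ^ N)%N by rewrite prod_nat_const card_ord expnM.
apply: eq_bigr => i _; case: ifPn => iB.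
  rewrite -(@card_shell N (depth t i).*2); last by rewrite ltn_double depth_lt.
  by congr (_ * _)%N; apply: eq_card => v; rewrite /F !inE iB.
rewrite muln1 -[X in (_ ^ X)%N]card_ord -card_bool -card_ffun.
by apply: eq_card => v; rewrite /F !inE (negbTE iB).
Qed.

Let xor_cells (c z : cells) : cells := [ffun i => [ffun m => z i m (+) c i m]].

Let xor_cellsK c : involutive (xor_cells c).
Proof. by move=> z; apply/ffunP => i; apply/ffunP => m; rewrite !ffunE -addbA addbb addbF. Qed.

Let kernel_pieces (c y : cells) t : xor_cells c y \in pieces t ->
  hump_height <= `|bump_kernel B hump_order c y| :> R.
Proof.
rewrite inE => /forallP h; rewrite /bump_kernel normr_prod.
have -> : hump_height = \prod_(i in B) ((4 ^ depth t i)%:R / 10) :> R.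
  rewrite /hump_height -(sum_depth t) [RHS]big_split/= prodr_const exprVn; congr (_ / _).
  by rewrite expn_sum natr_prod.
apply: ler_prod => i iB; rewrite divr_ge0//=.
have dN : ((depth t i).*2 < N)%N by rewrite ltn_double depth_lt.
have /(shellP dN)[h0 h1] : xor_cells c y i \in shell N (depth t i).*2.
  by have := h i; rewrite iB.
have E m : (m < N)%N -> digits (xor_cells c y i) m = digits (y i) m (+) digits (c i) m.
  by move=> mN; rewrite -[m]/(nat_of_ord (Ordinal mN)) !digitsE !ffunE.
apply: norlund_kernel_ge.
- by rewrite /hump_terms /depth; lia.
- exact: depth_lt.
- by rewrite /hump_terms; move: (w1) (B2); nia.
- by move=> m md; rewrite -E ?h0//; exact: ltn_trans dN.
- by rewrite -E.
Qed.

Lemma card_large_kernel_pivot (c : cells) :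
  (2 ^ (N * d) * w ^ b.-1 <= 2 ^ (hump_depth.*2 + b) *
   #|[set y : cells | (hump_height <= `|bump_kernel B hump_order c y| :> R)%R]%SET|)%N.
Proof.
set E := [set y | _]%SET.
(* Coordinates of t that [depth] ignores are frozen at 0; otherwise the same piece would be counted
   for several t. *)
pose G (i : 'I_d) : pred 'I_w.+1 := [pred k | ~~ ((i \in B) && (i != i0)) ==> (k == ord0)].
have cG : (w ^ b.-1 <= #|family G|)%N.
  rewrite card_family foldrE big_map big_enum/=.
  apply: (@leq_trans (\prod_(i < d) if (i \in B) && (i != i0) then w else 1)%N).
    rewrite -big_mkcond/= prod_nat_const [#|B|](cardD1 i0) i0B add1n/=.
    by rewrite (@eq_card _ _ [pred i | (i \in B) && (i != i0)])// => j; rewrite !inE andbC.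
  apply: leq_prod => i _; case: ifPn => iB.
    by rewrite (@eq_card _ _ predT) ?card_ord// => k; rewrite /G !inE iB.
  by apply/card_gt0P; exists ord0; rewrite /G !inE eqxx implybT.
have sub : (\sum_(t in family G) #|pieces t| <= #|E|)%N.
  have -> : #|E| = #|xor_cells c @^-1: E| by rewrite card_preimset//; exact: inv_inj (@xor_cellsK c).
  rewrite -sum1_card (eq_bigr (fun t => \sum_(z : cells) (z \in pieces t : nat))%N); last first.
    by move=> t _; rewrite -sum1_card big_mkcond; apply: eq_bigr => z _; case: (_ \in _).
  rewrite exchange_big/= [leqRHS]big_mkcond/=; apply: leq_sum => z _.
  have [[t tG zt]|nt] := pselect (exists2 t, t \in family G & z \in pieces t); last first.
    rewrite big1// => t tG; apply/eqP; rewrite eqb0; apply/negP => zt.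
    by apply: nt; exists t.
  have -> : z \in xor_cells c @^-1: E.
    by rewrite !inE (@kernel_pieces _ _ t)// xor_cellsK.
  rewrite (bigD1 t)//= zt big1 ?addn0// => t' /andP[t'G tt'].
  apply/eqP; rewrite eqb0; apply: contra_neqN tt' => zt'.
  apply/ffunP => i.
  have Gi (s : slack) : s \in family G -> ~~ ((i \in B) && (i != i0)) -> s i = ord0.
    by move=> /familyP/(_ i); rewrite !inE => + h; rewrite h => /eqP.
  case: (boolP ((i \in B) && (i != i0))) => [/andP[iB ii0]|ii0]; last by rewrite !Gi.
  move: zt zt'; rewrite !inE => /forallP/(_ i) + /forallP/(_ i); rewrite iB/=.
  have dN (s : slack) : ((depth s i).*2 < N)%N by rewrite ltn_double depth_lt.
  move=> z1 z2; have := shell_inj (dN t') (dN t) z2 z1.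
  rewrite /depth (negbTE ii0) => /eqP; rewrite -!mul2n eqn_pmul2l// eqn_add2l => /eqP tt.
  exact: val_inj.
rewrite mulnC; apply: (@leq_trans (#|family G| * 2 ^ (N * d))%N).
  by rewrite leq_mul2r cG orbT.
rewrite -sum_nat_const.
apply: (@leq_trans (2 ^ (hump_depth.*2 + b) * \sum_(t in family G) #|pieces t|)%N).
  by rewrite big_distrr/=; apply: leq_sum => t _; rewrite -(card_pieces t) mulnC.
by rewrite leq_mul2l sub orbT.
Qed.

End with_pivot.

Lemma card_large_kernel (c : cells) :
  (2 ^ (N * d) * w ^ b.-1 <= 2 ^ (hump_depth.*2 + b) *
   #|[set y : cells | (hump_height <= `|bump_kernel B hump_order c y| :> R)%R]%SET|)%N.
Proof.
have /card_gt0P[i0 i0B] : (0 < b)%N by exact: ltnW.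
exact: card_large_kernel_pivot i0B c.
Qed.

End large_kernel.

(** * Construction of one hump *)

Section single_hump.
Context {R : realType} {d : nat} (B : {set 'I_d}).
Notation point := (d.-tuple (measurableTypeR R)).
Notation cube := (unit_cube R d).
Notation mu := (lebesgue_tuple R d).
Notation b := #|B|.

Section fixed_scale.
Variables (w : nat) (M : R).
Hypotheses (B2 : (1 < b)%N) (w1 : (0 < w)%N) (M0 : 0 < M).
Notation N := (hump_level B w).
Notation n := (hump_order B w).
Notation D := (hump_depth B w).
Notation lam := (hump_height B w : R).
Notation word := {ffun 'I_N -> bool}.
Notation cells := {ffun 'I_d -> word}.

(** Just above the reciprocal of the proportion given by [card_large_kernel], as [random_translates]
    demands. *)
Definition hump_count : nat := (2 ^ (D.*2 + b) %/ w ^ b.-1).+1.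

Notation K := hump_count.

Let lam0 : 0 < lam.
Proof. by rewrite /hump_height divr_gt0 ?exprn_gt0// ltr0n expn_gt0. Qed.

Let W_le : (w ^ b.-1 <= 2 ^ (D.*2 + b))%N.
Proof.
apply: (@leq_trans ((2 ^ w) ^ b.-1)%N).
  by rewrite leq_exp2r; [exact/ltnW/ltn_expl|case: (b) B2 => // -[]].
by rewrite -expnM leq_exp2l// /hump_depth [(w * _)%N]mulnC; move: (b.-1 * w)%N (b * _)%N => Y Z; lia.
Qed.

(** [M * K%:R / lam] will bound the L1 norm of the hump. Each variable of B contributes 2 from the
    measure of its shell and 10 from the kernel estimate, whence 20; the leading 2 pays for rounding
    K up. *)
Lemma hump_mass_le :
  M * K%:R / lam * (w ^ b.-1)%:R <= 2 * M * 20 ^+ b.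
Proof.
have KW : (K * w ^ b.-1 <= 2 * 2 ^ (D.*2 + b))%N.
  rewrite /hump_count mulSn; have := leq_divM (2 ^ (D.*2 + b)) (w ^ b.-1).
  by move: W_le; lia.
have lamE : 2 * (2 ^ (D.*2 + b))%:R / lam = 2 * 20 ^+ b.
  rewrite /hump_height (_ : (2 ^ (D.*2 + b))%:R = (4 ^ D)%:R * 2 ^+ b :> R); last first.
    by rewrite expnD natrM -mul2n expnM [X in _ * X]natrX.
  have -> : (20 : R) = 2 * 10 by rewrite -natrM.
  rewrite exprMn; field.
  by rewrite expf_neq0//= pnatr_eq0 expn_eq0.
apply: (@le_trans _ _ (M * (2 * (2 ^ (D.*2 + b))%:R / lam))); last by rewrite lamE; lra.
rewrite -!mulrA ler_pM2l// mulrCA [leRHS]mulrA mulrC.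
rewrite ler_pM2r ?invr_gt0// mulrC -!natrM ler_nat mulnC//.
Qed.

(** The height of a single bump with coefficient M / lam; the hump takes only integer multiples of
    it as values. *)
Let H : R := M * (2 ^+ N) ^+ b / lam.

(** Holds because [lam <= 4 ^ D] and [w + 2 * D <= N * b]. It makes the nonzero values as large as
    desired when w grows. *)
Lemma hump_large : M * w%:R <= H.
Proof.
rewrite /H -mulrA ler_pM2l// ler_pdivlMr// /hump_height.
rewrite mulrA ler_pdivrMr ?exprn_gt0//.
apply: (@le_trans _ _ ((2 ^+ N) ^+ b)).
  rewrite -natrM -exprM -natrX ler_nat.
  apply: (@leq_trans (2 ^ w * 4 ^ D)%N); first by rewrite leq_mul2r ltnW ?orbT// ltn_expl.
  rewrite (_ : 4 = 2 ^ 2)%N// -expnM -expnD leq_exp2l//.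
  by rewrite /hump_level /hump_terms /hump_depth; move: (B2); case: (b) => // b'; nia.
by rewrite ler_peMr ?exprn_ge0// exprn_ege1// ler1n.
Qed.

Lemma bumpE (y c : cells) :
  bump B y c = (2 ^+ N) ^+ b * [forall (i | i \in B), c i == y i]%:R :> R.
Proof.
rewrite /bump big_split/= prodr_const; congr (_ * _).
have [/forallP h|] := boolP [forall (i | i \in B), c i == y i].
  by rewrite big1// => i iB; have := h i; rewrite iB/= => ->.
rewrite negb_forall => /existsP[i]; rewrite negb_imply => /andP[iB ci].
by rewrite (bigD1 i)//= (negbTE ci) mul0r.
Qed.

(** Read off from the coefficient of index 0. *)
Lemma sum_bump (y : cells) : \sum_c bump B y c = (2 ^+ N) ^+ d :> R.
Proof.
have := @cell_coef_bump R d B N y (fun=> 0%N) (fun=> expn_gt0 2 N).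
rewrite big1; last by move=> i _; rewrite walsh_bits0 eqxx; case: ifP.
rewrite /cell_coef; under eq_bigr => c _.
  rewrite big1 ?mulr1; last by move=> i _; rewrite walsh_bits0.
  over.
rewrite exprVn => /(canRL (mulVKf _)) ->; first by rewrite mulr1.
by rewrite !expf_neq0.
Qed.

Lemma hump_step : exists F : cells -> R,
  [/\ forall c, F c != 0 -> H <= `|F c|,
      forall c, `|F c| <= M * K%:R / lam * (2 ^+ N) ^+ b,
      ((2 ^+ N)^-1) ^+ d * \sum_c `|F c| <= M * K%:R / lam
    & ((4^-1)%:E <= mu (cube `&` [set x |
         (M <= `|mixed_log_mean B (fun=> n) (F \o cell N) x|)%R]))%E].
Proof.
have nN : (n <= 2 ^ N)%N.
  have := alternating_digits3 (hump_terms B w).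
  by rewrite /hump_level -mul2n expnM (_ : 2 ^ 2 = 4)%N// /hump_order; lia.
have n2 : (2 <= n)%N.
  apply: leq_trans (alternating_digits_ge _); rewrite /hump_terms.
  by move: (B2) (w1); nia.
have cC : #|{: cells}| = (2 ^ (N * d))%N.
  by rewrite card_ffun card_ffun card_bool !card_ord expnM.
have hK (c : cells) :
    (#|{: cells}| <= K * #|[set y | (lam <= `|bump_kernel B n c y|)%R]%SET|)%N.
  have W0 : (0 < w ^ b.-1)%N by rewrite expn_gt0 w1.
  rewrite -(leq_pmul2r W0) cC; apply: leq_trans (@card_large_kernel R d B w B2 w1 c) _.
  rewrite mulnAC leq_mul2r; apply/orP; right.
  by rewrite ltnW// /hump_count ltn_ceil.
have T0 : (0 < #|{: cells}|)%N by rewrite cC expn_gt0.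
have [y [eps good]] := random_translates T0 hK.
(* The factor M / lam turns a signed kernel sum of size lam into a mean of size M. *)
pose a k := M / lam * (-1) ^+ eps k.
pose F (c : cells) := \sum_k a k * bump B (y k) c.
have bump_ge0 (y' c : cells) : 0 <= bump B y' c :> R by rewrite bumpE mulr_ge0// !exprn_ge0.
have norm_a k : `|a k| = M / lam.
  by rewrite normrM normr_sign mulr1 ger0_norm// divr_ge0// ltW.
have FT x : mixed_log_mean B (fun=> n) (F \o cell N) x =
    M / lam * \sum_k (-1) ^+ eps k * bump_kernel B n (cell N x) (y k).
  rewrite mixed_log_mean_cell//.
  rewrite (_ : cell_coef F = fun j => \sum_k a k * cell_coef (bump B (y k)) j); last first.
    apply/funext => j; rewrite /cell_coef; under [RHS]eq_bigr do rewrite mulrCA.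
    rewrite -mulr_sumr; congr (_ * _); under [RHS]eq_bigr do rewrite mulr_sumr.
    rewrite exchange_big/=; apply: eq_bigr => c _; rewrite mulr_suml.
    by apply: eq_bigr => k _; rewrite mulrA.
  rewrite log_mean_coef_sum mulr_sumr; apply: eq_bigr => k _.
  by rewrite log_mean_bump// /a mulrA.
exists F; split.
(* z is the signed number of bumps present at c: overlapping bumps may cancel completely, but never
   leave a value strictly between 0 and H. *)
- move=> c; pose z : int := \sum_k (-1) ^+ eps k * [forall (i | i \in B), c i == y k i]%:R.
  have -> : F c = H * z%:~R.
    rewrite /z rmorph_sum/= mulr_sumr; apply: eq_bigr => k _.
    rewrite bumpE rmorphM/= rmorph_sign rmorph_nat /a /H; ring.
  rewrite mulf_eq0 negb_or intr_eq0 => /andP[_ z0].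
  have H0 : 0 <= H by rewrite /H divr_ge0 ?mulr_ge0 ?exprn_ge0 ?ltW.
  rewrite normrM (ger0_norm H0) ler_peMr// -intr_norm ler1z.
  by rewrite -gtz0_ge1 normr_gt0.
- move=> c; apply: le_trans (ler_norm_sum _ _ _) _.
  apply: (@le_trans _ _ (\sum_(k < K) M / lam * (2 ^+ N) ^+ b)).
    apply: ler_sum => k _; rewrite normrM norm_a ler_wpM2l ?divr_ge0 ?(ltW M0) ?(ltW lam0)//.
    rewrite ger0_norm// bumpE ler_piMr ?exprn_ge0//.
    by rewrite lern1 leq_b1.
  rewrite sumr_const card_ord -mulr_natr le_eqVlt; apply/orP; left; apply/eqP; ring.
- apply: (@le_trans _ _ (((2 ^+ N)^-1) ^+ d * \sum_c \sum_k M / lam * bump B (y k) c)).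
    rewrite ler_wpM2l ?exprn_ge0 ?invr_ge0 ?exprn_ge0//; apply: ler_sum => c _.
    apply: le_trans (ler_norm_sum _ _ _) _; apply: ler_sum => k _.
    by rewrite normrM norm_a ger0_norm.
  rewrite exchange_big/=; under eq_bigr do rewrite -mulr_sumr sum_bump.
  rewrite sumr_const card_ord exprVn -mulr_natr le_eqVlt; apply/orP; left; apply/eqP.
  by field; rewrite !expf_neq0//= lt0r_neq0.
- rewrite (_ : _ `&` _ = cube `&` [set x | [pred c |
      lam <= `|\sum_k (-1) ^+ eps k * bump_kernel B n c (y k)|] (cell N x)]); last first.
    congr (_ `&` _); apply/funext => x /=; rewrite FT normrM; congr is_true.
    rewrite (@ger0_norm _ (M / lam)); last by rewrite divr_ge0// ltW.
    by rewrite mulrAC ler_pdivlMr// ler_pM2l.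
  rewrite lebesgue_cell_pred lee_fin exprVn.
  rewrite ler_pdivlMl ?exprn_gt0// -exprM -natrX -cC ler_pdivrMr//.
  by rewrite mulrC -natrM ler_nat; apply: leq_trans good _; rewrite cardsE.
Qed.

End fixed_scale.

(** The factor 2 leaves room for the earlier terms, which a hump dominates where it is nonzero; the
    value 0 at 0 discards [phi 0] off the support. *)
Definition double_phi (phi : R -> R) (y : R) : R := if y == 0 then 0 else phi (2 * `|y|).

Lemma log_mean_hump (phi : R -> R) (B2 : (1 < b)%N)
    (phi_littleo : forall e : R, 0 < e ->
       \forall x \near +oo, `|phi x| <= e * `|x * ln x ^+ (b - 1)|)
    (M e H0 : R) (n0 : nat) : 0 < M -> 0 < e ->
  exists (n : 'I_d -> nat) (N : nat) (F : {ffun 'I_d -> {ffun 'I_N -> bool}} -> R),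
  let f := F \o @cell R d N in
  [/\ forall i, (n0 <= n i)%N, forall x, f x != 0 -> H0 <= `|f x|,
      (\int[mu]_(x in cube) `|f x|%:E <= e%:E)%E,
      (\int[mu]_(x in cube) (double_phi phi (f x))%:E <= e%:E)%E
    & ((4^-1)%:E <= mu (cube `&` [set x |
         (M <= `|mixed_log_mean B n f x|)%R]))%E].
Proof.
move=> M0 e0; pose A := 2 * M * 20 ^+ b.
(* Below, T = (20 b b) w bounds ln(2|f|), so T^(b-1) = Q w^(b-1), while the mass nu satisfies nu
   w^(b-1) <= A; e' is chosen so that 2 e' Q A = e. *)
have A0 : 0 < A by rewrite !mulr_gt0// exprn_gt0.
pose Q : R := (20 * b * b)%:R ^+ b.-1.
have Q0 : 0 < Q by rewrite exprn_gt0// ltr0n !muln_gt0 (ltnW B2).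
pose e' := e / (2 * Q * A).
have e'0 : 0 < e' by rewrite divr_gt0// !mulr_gt0.
have [x0 [_ hx0]] := phi_littleo e' e'0.
pose X : R := n0%:R + 1 + A / e + 2 * A + (`|H0| + `|x0| + 1) / M.
pose w := Num.bound X.
have X0 : 0 <= X.
  by rewrite !addr_ge0 ?divr_ge0 ?mulr_ge0 ?addr_ge0// ?ltW.
have Xw : X < w%:R by exact: archi_boundP.
have p1 : 0 <= A / e by rewrite divr_ge0// ltW.
(* The summands of X are one per demand on w: n0 for the order n, 1 for w > 0, A / e for the L1
   norm, 2 A for nu <= 1/2, and this last one for the height H. *)
have p2 : 0 <= (`|H0| + `|x0| + 1) / M by rewrite divr_ge0 ?addr_ge0// ltW.
have p3 : 0 <= n0%:R :> R by [].
have w1 : (0 < w)%N by rewrite -(ltr_nat R); rewrite /X in Xw; lra.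
have wn0 : (n0 <= w)%N by rewrite -(ler_nat R); rewrite /X in Xw; lra.
have [F [F1 F2 F3 F4]] := hump_step B2 w1 M0.
exists (fun=> hump_order B w), (hump_level B w), F.
set nu := M * (hump_count w)%:R / hump_height B w in F2 F3.
have hnu : nu * (w ^ b.-1)%:R <= A by exact: hump_mass_le.
have nu0 : 0 <= nu.
  by rewrite divr_ge0 ?mulr_ge0 ?(ltW M0)// /hump_height divr_ge0// exprn_ge0.
have nuw : nu * w%:R <= A.
  apply: le_trans hnu; rewrite ler_wpM2l// ler_nat -[leqLHS]expn1 leq_pexp2l//.
  by case: (b) B2 => // -[].
have nue : nu <= e.
  have : A / e < w%:R by rewrite /X in Xw; lra.
  rewrite ltr_pdivrMr// => h.
  rewrite -(@ler_pM2r _ w%:R) ?ltr0n//; rewrite mulrC in h.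
  by apply: le_trans nuw _; exact: ltW.
have nu2 : nu <= 2^-1.
  have h : 2 * A < w%:R by rewrite /X in Xw; lra.
  by rewrite -(@ler_pM2r _ w%:R) ?ltr0n//; lra.
set H := M * _ / _ in F1.
have HH : `|H0| + `|x0| + 1 <= H.
  apply: le_trans (hump_large B2 w1 M0).
  have h : (`|H0| + `|x0| + 1) / M < w%:R by rewrite /X in Xw; lra.
  by rewrite mulrC -ler_pdivrMr// ltW.
split => //.
- by move=> i; apply: leq_trans (alternating_digits_ge _); apply: leq_trans wn0 _; rewrite leq_pmull// muln_gt0 (ltnW B2).
- move=> x /F1 h; apply: le_trans h; apply: le_trans HH.
  by have := ler_norm H0; have := normr_ge0 x0; lra.
- by rewrite (integral_cell (fun c => `|F c|)) lee_fin (le_trans F3).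
- rewrite (integral_cell (fun c => double_phi phi (F c))) lee_fin.
  set T := (hump_level B w * b)%N.
  have key c : double_phi phi (F c) <= 2 * e' * T%:R ^+ b.-1 * `|F c|.
    rewrite /double_phi; case: ifPn => [/eqP ->|Fc0].
      by rewrite normr0 mulr0.
    have hF := F1 c Fc0; set x := 2 * `|F c|.
    have x0x : x0 < x by have := ler_norm x0; have := normr_ge0 H0; have := normr_ge0 x0; rewrite /x; lra.
    have x1 : 1 <= x by have := normr_ge0 x0; have := normr_ge0 H0; rewrite /x; lra.
    (* nu <= 1/2 absorbs the factor 2 of [double_phi]. *)
    have xT : x <= 2 ^+ T.
      have := F2 c; have : nu * (2 ^+ hump_level B w) ^+ b <= 2^-1 * 2 ^+ T.
        by rewrite -exprM ler_wpM2r ?exprn_ge0.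
      by rewrite /x; lra.
    have lnx0 : 0 <= ln x by rewrite ln_ge0.
    have lnxT : ln x <= T%:R.
      apply: (@le_trans _ _ (ln (2 ^+ T))).
        by rewrite ler_ln ?posrE ?exprn_gt0//; lra.
      rewrite lnXn// -[leRHS]mulr1 mulr_natl lerMn2r; apply/orP; right.
      by have := @le_ln1Dx R 1; rewrite (_ : 1 + 1 = 2) //; apply; lra.
    apply: le_trans (ler_norm _) _; apply: le_trans (hx0 x x0x) _.
    rewrite normrM normrX (ger0_norm lnx0) (@ger0_norm _ x); last by lra.
    rewrite subn1 (_ : 2 * e' * T%:R ^+ b.-1 * `|F c| = e' * (x * T%:R ^+ b.-1)); last by rewrite /x; ring.
    rewrite ler_pM2l// ler_wpM2l//; first by lra.
    by apply: lerXn2r; rewrite ?nnegrE.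
  apply: (@le_trans _ _ (2 * e' * T%:R ^+ b.-1 * nu)).
    apply: (@le_trans _ _ (2 * e' * T%:R ^+ b.-1 * (((2 ^+ hump_level B w)^-1) ^+ d * \sum_c `|F c|))).
      rewrite mulrCA ler_wpM2l ?exprn_ge0 ?invr_ge0 ?exprn_ge0// mulr_sumr.
      by apply: ler_sum => c _; exact: key.
    by apply: ler_wpM2l => //; rewrite mulr_ge0 ?exprn_ge0// mulr_ge0// ltW.
  have -> : T%:R ^+ b.-1 = Q * (w ^ b.-1)%:R :> R.
    rewrite /Q natrX -exprMn -natrM; congr (_%:R ^+ _).
    by rewrite /T /hump_level /hump_terms -mul2n !mulnA mulnAC.
  have -> : 2 * e' * (Q * (w ^ b.-1)%:R) * nu = 2 * e' * Q * (nu * (w ^ b.-1)%:R) by ring.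
  apply: (@le_trans _ _ (2 * e' * Q * A)).
    by apply: ler_wpM2l => //; rewrite mulr_ge0 ?(ltW Q0)// mulr_ge0// ltW.
  rewrite le_eqVlt; apply/orP; left; apply/eqP; rewrite /e'; field.
  by rewrite !lt0r_neq0.
Qed.

End single_hump.

(** * Summation of a sequence of humps *)

(** [phi] is monotone on the half-line only; replacing its argument by the maximum with 0 makes it
    monotone on R, hence measurable. *)
Lemma measurable_nondecreasing_norm (R : realType) (disp : measure_display)
    (T : measurableType disp) (D : set T) (phi : R -> R) (f : T -> R) :
  (forall x y : R, 0 <= x -> x <= y -> phi x <= phi y) ->
  measurable_fun D f -> measurable_fun D (fun x => phi `|f x|).
Proof.
move=> phi_nd mf.
rewrite (_ : (fun x => _) = (fun y => phi (Num.max 0 y)) \o (fun x => `|f x|)); last first.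
  by apply/funext => x /=; rewrite max_r.
apply: measurableT_comp; last exact: measurableT_comp.
apply: nondecreasing_measurable => // y z yz; apply: phi_nd.
  by rewrite le_max lexx.
by rewrite ge_max !le_max lexx/= yz orbT.
Qed.

Section sum_of_humps.
Context {R : realType} {disp : measure_display} {T : measurableType disp}.
Variables (mu : {measure set T -> \bar R}) (D : set T) (phi : R -> R).
Variables (h : nat -> T -> R) (tau : nat -> R).
Hypotheses (mD : measurable D) (D_fin : (mu D < +oo)%E).
Hypothesis phi_ge0 : forall x : R, 0 <= x -> 0 <= phi x.
Hypothesis phi_nd : forall x y : R, 0 <= x -> x <= y -> phi x <= phi y.
Hypothesis mh : forall k, measurable_fun D (h k).
Hypothesis mphih : forall k, measurable_fun D (double_phi phi \o h k).
Hypothesis h_large : forall k x, h k x != 0 ->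
  1 <= `|h k x| /\ `|\sum_(i < k) h i x| <= `|h k x|.
Hypothesis tau_half : forall k, 0 <= tau k /\ 2 * tau k.+1 <= tau k.
Hypothesis int_h : forall k, (\int[mu]_(x in D) `|h k x|%:E <= (tau k)%:E)%E.
Hypothesis int_phih :
  forall k, (\int[mu]_(x in D) (double_phi phi (h k x))%:E <= (tau k)%:E)%E.

Let P k x := \sum_(i < k) h i x.

Let sum_tau n k : \sum_(i < n) tau (k + i) <= 2 * tau k.
Proof.
elim: n k => [|n ih] k; first by rewrite big_ord0 mulr_ge0//; case: (tau_half k).
rewrite big_ord_recl addn0; have := ih k.+1; have [] := tau_half k.
under [X in _ -> _ -> _ -> _ + X <= _]eq_bigr do rewrite /= /fintype.bump/= add1n addnS -addSn.
by move=> ? ? ?; lra.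
Qed.

Let double_phi_ge0 y : 0 <= double_phi phi y.
Proof. by rewrite /double_phi; case: ifP => // _; apply: phi_ge0; rewrite mulr_ge0. Qed.

Let mean_finite (u : nat -> T -> R) : (forall k x, 0 <= u k x) ->
  (forall k, measurable_fun D (u k)) ->
  (forall k, (\int[mu]_(x in D) (u k x)%:E <= (tau k)%:E)%E) ->
  (\int[mu]_(x in D) (\sum_(k <oo) (u k x)%:E) <= (2 * tau 0)%:E)%E.
Proof.
move=> u0 mU iu.
rewrite integral_nneseries//; last 2 first.
- by move=> k; exact/measurable_EFinP.
- by move=> k x _; rewrite lee_fin.
apply: lime_le.
  by apply: is_cvg_nneseries => k _ _; apply: integral_ge0 => x _; rewrite lee_fin.
near=> n; apply: (@le_trans _ _ (\sum_(0 <= k < n) (tau k)%:E)%E).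
  by apply: lee_sum => k _; exact: iu.
by rewrite sumEFin lee_fin big_mkord; exact: (sum_tau n 0).
Unshelve. all: by end_near. Qed.

Let total x : \bar R := (\sum_(k <oo) `|h k x|%:E)%E.

Let measurable_total : measurable_fun D total.
Proof.
apply: ge0_emeasurable_sum => [k x _ _|k _]; first by rewrite lee_fin.
by apply/measurable_EFinP; exact: measurableT_comp.
Qed.

Let total_ge0 x : (0 <= total x)%E.
Proof. by apply: nneseries_ge0 => k _ _; rewrite lee_fin. Qed.

Let integrable_total : mu.-integrable D total.
Proof.
apply/integrableP; split => //.
under eq_integral do rewrite gee0_abs//.
apply: le_lt_trans (mean_finite (u := fun k x => `|h k x|) _ _ _) (ltry _) => //.
by move=> k; exact: measurableT_comp.
Qed.

(* A nonzero term is at least 1 in absolute value, so a finite total leaves only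
   finitely many of them. *)
Let eventually0 x : total x \is a fin_num ->
  exists m, forall k, (m <= k)%N -> h k x = 0.
Proof.
move=> tx; apply/not_existsP => H.
have big K : exists n, K%:R <= \sum_(0 <= i < n) `|h i x|.
  elim: K => [|K [n hn]]; first by exists 0%N; rewrite big_geq.
  have /existsNP[k /not_implyP[nk /eqP hk]] := H n.
  exists k.+1; rewrite -natr1 big_nat_recr//=; apply: lerD; last by have [] := h_large hk.
  apply: le_trans hn _; rewrite [leRHS](@big_cat_nat _ _ _ n)//= lerDl.
  exact: sumr_ge0.
have [n] := big (Num.bound (fine (total x))); apply/negP; rewrite -ltNge.
apply: le_lt_trans (archi_boundP _); last by rewrite fine_ge0.
rewrite -lee_fin fineK// -sumEFin.
by apply: nneseries_lim_ge => k _ _; rewrite lee_fin.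
Qed.

(** The upper limit is measurable without any convergence; off a null set the partial sums are
    eventually constant. *)
Let f x : R := fine (limn_esup (fun k => (P k x)%:E)).

Let P_stable x m k : (forall k, (m <= k)%N -> h k x = 0) -> (m <= k)%N -> P k x = P m x.
Proof.
move=> hm mk; rewrite /P -!(big_mkord predT (fun i => h i x)) (@big_cat_nat _ _ _ m)//=.
by rewrite [X in _ + X]big1_seq ?addr0// => i /andP[_]; rewrite mem_index_iota => /andP[/hm].
Qed.

Let cvg_P x m : (forall k, (m <= k)%N -> h k x = 0) ->
  (fun k => (P k x)%:E) @ \oo --> (P m x)%:E.
Proof.
move=> hm; apply: cvg_near_cst; exists m => // k mk; by rewrite /= (P_stable hm mk).
Qed.

Let fE x m : (forall k, (m <= k)%N -> h k x = 0) -> f x = P m x.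
Proof. by move=> hm; rewrite /f; have [_ ->] := cvg_limn_einf_sup (cvg_P hm). Qed.

Let mP k : measurable_fun D (P k).
Proof. exact: measurable_sum. Qed.

Let mf : measurable_fun D f.
Proof.
apply: measurableT_comp => //; apply: measurable_fun_limn_esup => k.
exact/measurable_EFinP.
Qed.

Let dominated : [/\ mu.-integrable D (EFin \o f),
  [sequence (\int[mu]_(x in D) `|(P n x)%:E - (f x)%:E|)%E]_n @ \oo --> 0%E &
  [sequence (\int[mu]_(x in D) (P n x)%:E)%E]_n @ \oo --> (\int[mu]_(x in D) (f x)%:E)%E].
Proof.
apply: (@dominated_convergence _ _ _ mu D mD (fun k x => (P k x)%:E) (EFin \o f) total).
- by move=> k; exact/measurable_EFinP.
- exact/measurable_EFinP.
- apply: filterS (integrable_ae mD integrable_total) => x tx Dx.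
  by have [m hm] := eventually0 (tx Dx); rewrite /= (fE hm); exact: cvg_P.
- exact: integrable_total.
- apply: aeW => x n Dx; rewrite abse_EFin; apply: (@le_trans _ _ (\sum_(0 <= i < n) `|h i x|%:E)%E).
    by rewrite sumEFin lee_fin big_mkord ler_norm_sum.
  by apply: nneseries_lim_ge => k _ _; rewrite lee_fin.
Qed.

(** Only the last nonzero term counts: there |P| is at most twice that term. If all terms vanish,
    [phi 0] remains. *)
Let phi_P m x : phi `|P m x| <= phi 0 + \sum_(0 <= i < m) double_phi phi (h i x).
Proof.
elim: m => [|m ih]; first by rewrite /P big_ord0 normr0 big_geq ?addr0.
rewrite big_nat_recr//= addrA; have [hm|hm] := eqVneq (h m x) 0.
  by rewrite /P big_ord_recr/= hm addr0 (le_trans ih)// lerDl.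
apply: (@le_trans _ _ (double_phi phi (h m x))).
  rewrite /double_phi (negbTE hm); apply: phi_nd => //.
  rewrite /P big_ord_recr/=; have [_ Ph] := h_large hm.
  by apply: le_trans (ler_normD _ _) _; move: Ph; move: `|\sum_(_ < _) _| => A; lra.
by rewrite lerDr addr_ge0 ?phi_ge0// sumr_ge0.
Qed.

Let measurable_phif : measurable_fun D (fun x => phi `|f x|).
Proof. exact: measurable_nondecreasing_norm. Qed.

Lemma sum_of_humps : exists f : T -> R,
  [/\ mu.-integrable D (EFin \o f),
      (\int[mu]_(x in D) (phi `|f x|)%:E < +oo)%E &
      forall k, (\int[mu]_(x in D) `|f x - \sum_(i < k) h i x|%:E <= (2 * tau k)%:E)%E].
Proof.
have [intf cvgf _] := dominated.
exists f; split => //.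
- pose S x : \bar R := (\sum_(k <oo) (double_phi phi (h k x))%:E)%E.
  have S0 x : (0 <= S x)%E by apply: nneseries_ge0 => k _ _; rewrite lee_fin.
  have mS : measurable_fun D S.
    apply: ge0_emeasurable_sum => [k x _ _|k _]; first by rewrite lee_fin.
    by apply/measurable_EFinP; exact: (mphih k).
  have p0 : 0 <= phi 0 by exact: phi_ge0.
  (* [phi 0] may be positive, but D has finite measure. *)
  apply: (@le_lt_trans _ _ (\int[mu]_(x in D) ((phi 0)%:E + S x))%E).
    apply: ae_ge0_le_integral => //.
    + by move=> x _; rewrite lee_fin phi_ge0.
    + exact/measurable_EFinP.
    + by move=> x _; rewrite adde_ge0// lee_fin.
    + by apply: emeasurable_funD => //; exact: measurable_cst.
    apply: filterS (integrable_ae mD integrable_total) => x tx Dx.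
    have [m hm] := eventually0 (tx Dx); rewrite (fE hm).
    apply: (@le_trans _ _ ((phi 0)%:E + \sum_(0 <= i < m) (double_phi phi (h i x))%:E)%E).
      by rewrite sumEFin -EFinD lee_fin phi_P.
    by apply: leeD2l; apply: nneseries_lim_ge => k _ _; rewrite lee_fin.
  rewrite ge0_integralD//.
  apply: lte_add_pinfty.
    by rewrite integral_cst// lte_mul_pinfty// lee_fin.
  apply: le_lt_trans (mean_finite (u := fun k => double_phi phi \o h k) _ _ _) (ltry _) => //=.
- move=> k.
  (* For m >= k, |f - P_k| is at most |P_m - f| plus the sum of the |h_i| with k <= i < m; the first
     part tends to 0 in L1 as m grows, the second has integral at most 2 tau k. *)
  apply: (@cvge_to_ge _ \oo _ _ (fun m => (\int[mu]_(x in D) `|(P m x)%:E - (f x)%:E| + (2 * tau k)%:E)%E)).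
    rewrite -[X in _ --> X]add0e; apply: cvgeD => //; exact: cvg_cst.
  exists k => // m /= km.
  have mPf : measurable_fun D (fun x => `|P m x - f x|).
    by apply: measurableT_comp => //; exact: measurable_funB.
  have -> : (\int[mu]_(x in D) `|(P m x)%:E - (f x)%:E| = \int[mu]_(x in D) `|P m x - f x|%:E)%E by [].
  pose H x := (\sum_(i < m - k) `|h (k + i)%N x|%:E)%E.
  have mhi i : measurable_fun D (fun x => `|h i x|%:E).
    by apply/measurable_EFinP; exact: measurableT_comp.
  have mH : measurable_fun D H by exact: emeasurable_sum.
  have H0 x : (0 <= H x)%E by apply: sume_ge0 => i _; rewrite lee_fin.
  apply: (@le_trans _ _ (\int[mu]_(x in D) (`|P m x - f x|%:E + H x))%E).
    apply: ge0_le_integral => //.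
    + apply/measurable_EFinP; apply: measurableT_comp => //.
      by apply: measurable_funB => //; exact: mP.
    + by apply: emeasurable_funD => //; exact/measurable_EFinP.
    move=> x _; rewrite /H sumEFin -EFinD lee_fin.
    have -> : P m x = \sum_(i < k) h i x + \sum_(i < m - k) h (k + i)%N x.
      by rewrite -{1}(subnKC km) /P big_split_ord.
    have := ler_norm_sum (index_enum 'I_(m - k)) (fun i => h (k + i)%N x) predT.
    move: (\sum_(i < k) _) (\sum_(i < m - k) h _ _) (\sum_(i < m - k) `|_|) => a b c bc.
    have -> : f x - a = b - (a + b - f x) by ring.
    by apply: le_trans (ler_normB _ _) _; rewrite addrC lerD2l.
  rewrite ge0_integralD//; last exact/measurable_EFinP.
  apply: leeD2l; rewrite ge0_integral_sum//.
  apply: le_trans (_ : (\sum_(i < m - k) (tau (k + i))%:E <= _)%E).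
    by apply: lee_sum => i _; exact: int_h.
  by rewrite sumEFin lee_fin sum_tau.
Qed.

End sum_of_humps.

(** * Convergence in measure implies boundedness in measure *)

Section bounded_in_measure.
Context {R : realType} {disp : measure_display} {T : measurableType disp}.
Variables (mu : {measure set T -> \bar R}) (D : set T).
Hypotheses (mD : measurable D) (D_fin : (mu D < +oo)%E).

Lemma measurable_superlevel (f : T -> R) (A : R) : measurable_fun D f ->
  measurable (D `&` [set x | (A <= `|f x|)%R]).
Proof.
move=> mf; apply: (@emeasurable_fun_c_infty _ _ _ D (EFin \o (fun x => `|f x|)) mD _ A%:E).
by apply/measurable_EFinP; exact: measurableT_comp.
Qed.

Lemma cvge0_near_le (I : Type) (G : set_system I) {FG : ProperFilter G}
    (u : I -> \bar R) (e : R) :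
  (u n @[n --> G] --> 0%E) -> 0 < e -> \forall n \near G, (u n <= e%:E)%E.
Proof.
move=> /fine_cvgP[ufin /cvgr0Pnorm_le ue] e0; move: (ue _ e0) => {}ue.
near=> n; rewrite -[u n]fineK; last by near: n.
by rewrite lee_fin (le_trans (ler_norm _))//; near: n.
Unshelve. all: by end_near. Qed.

(** The superlevel sets decrease to the null set where g is infinite; continuity from above needs
    the finite measure of D. *)
Lemma finite_tail_measure (g : T -> \bar R) (e : R) :
  measurable_fun D g -> {ae mu, forall x, D x -> g x \is a fin_num} -> 0 < e ->
  exists k : nat, (mu (D `&` [set x | k%:R%:E <= `|g x|]) <= e%:E)%E.
Proof.
move=> mg gfin e0; pose S k := D `&` [set x | (k%:R%:E <= `|g x|)%E].
have mabs : measurable_fun D (fun x => `|g x|%E) by exact: measurableT_comp.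
have mS k : measurable (S k) by exact: emeasurable_fun_c_infty.
have S0 : mu (\bigcap_k S k) = 0%E.
  apply: measure_negligible; first exact: bigcapT_measurable.
  apply: negligibleS gfin => x /= Sx /(_ (Sx 0%N I).1) gx.
  have := (Sx (Num.bound (fine `|g x|%E)) I).2; rewrite /= -[X in (_ <= X)%E]fineK ?abse_fin_num//.
  by rewrite lee_fin leNgt => /negP; apply; apply: archi_boundP; rewrite fine_ge0.
have SD : (mu (S 0%N) < +oo)%E.
  by apply: le_lt_trans D_fin; apply: le_measure; rewrite ?inE// => x [].
have /nonincreasing_cvg_mu/(_ mS) : (mu (S 0%N) < +oo)%E by [].
have mcap : measurable (\bigcap_k S k) by exact: bigcapT_measurable.
move=> /(_ mcap); rewrite S0 => cvgS.
have {}cvgS : mu (S k) @[k --> \oo] --> 0%E.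
  apply: cvgS => m n mn; apply/subsetPset => x [Dx /= nx]; split => //=.
  by apply: le_trans nx; rewrite lee_fin ler_nat.
by have [k _ /(_ k (leqnn k))] := cvge0_near_le cvgS e0; exists k.
Qed.

Lemma cvg_in_measure_bounded (I : Type) (G : set_system I) {FG : ProperFilter G}
    (F : I -> T -> R) (g : T -> \bar R) (e : R) :
  (forall n, measurable_fun D (F n)) -> measurable_fun D g ->
  {ae mu, forall x, D x -> g x \is a fin_num} ->
  cvg_in_measure mu D G F g -> 0 < e ->
  exists A : R, \forall n \near G, (mu (D `&` [set x | (A <= `|F n x|)%R]) <= e%:E)%E.
Proof.
move=> mF mg gfin Fg e0; have e2 : 0 < e / 2 by rewrite divr_gt0.
have [k hk] := finite_tail_measure mg gfin e2.
(* [|F n x| >= k + 1] forces [|g x| >= k] or [|F n x - g x| >= 1], each on a set of measure at most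
   e / 2. *)
exists (k%:R + 1); apply: filterS (cvge0_near_le (Fg 1 ltr01) e2) => n hn.
have m1 : measurable (D `&` [set x | (k%:R%:E <= `|g x|)%E]).
  by apply: emeasurable_fun_c_infty => //; exact: measurableT_comp.
have m2 : measurable (D `&` [set x | (1%:E <= `|(F n x)%:E - g x|)%E]).
  apply: emeasurable_fun_c_infty => //; apply: measurableT_comp => //.
  by apply: emeasurable_funB => //; exact/measurable_EFinP.
apply: le_trans (_ : (e / 2)%:E + (e / 2)%:E <= _)%E; last by rewrite -EFinD lee_fin; lra.
apply: le_trans (leeD hk hn); apply: le_trans (measureU2 _ m1 m2).
apply: le_measure; rewrite ?inE//.
- exact: measurable_superlevel.
- exact: measurableU.
- move=> x [Dx /= Fx]; case: (leP k%:R%:E `|g x|%E) => gx; first by left.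
  right; split => //=; case: (g x) gx => [r| |]//=; rewrite ?lte_fin ?lee_fin => rk.
  by have := ler_normD (F n x - r) r; rewrite subrK; lra.
Qed.

End bounded_in_measure.

(** * Measurability, linearity and L1 bounds of the means *)

Section log_mean_of_functions.
Context {R : realType} {d : nat} (B : {set 'I_d}).
Notation point := (d.-tuple (measurableTypeR R)).
Notation cube := (unit_cube R d).
Notation mu := (lebesgue_tuple R d).
Implicit Types (f g : point -> R) (n : 'I_d -> nat).

Lemma measurable_mwalsh (j : 'I_d -> nat) : measurable_fun cube (@mwalsh R d j).
Proof.
pose N := (\max_i j i)%N.
rewrite (_ : @mwalsh R d j = (fun c : {ffun 'I_d -> {ffun 'I_N -> bool}} =>
  \prod_i walsh_bits (j i) (digits (c i))) \o cell N).
  exact: measurable_fun_cell.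
apply/funext => x; apply: mwalsh_cell => i.
have jN : (j i <= N)%N by exact: leq_bigmax.
by rewrite (leq_trans (ltn_expl (j i) (isT : 1 < 2)%N))// leq_exp2l.
Qed.

Lemma measurable_box_sum a b (F : ('I_d -> nat) -> point -> R) :
  (forall j, measurable_fun cube (F j)) ->
  measurable_fun cube (fun x => box_sum a b (F^~ x)).
Proof.
move=> mF; rewrite (_ : (fun x => _) = fun x =>
    \sum_(j : {ffun 'I_d -> 'I_(\max_(i < d) b i)})
      if [forall i, (a <= j i < b i)%N] then F (fun i => j i) x else 0); last first.
  by apply/funext => x; exact: big_mkcond.
by apply: measurable_sum => j; case: [forall i, (a <= j i < b i)%N].
Qed.

Lemma measurable_mixed_log_mean n f : measurable_fun cube (mixed_log_mean B n f).
Proof.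
apply: measurable_funM => //.
apply: (@measurable_box_sum 1 n (fun i x => walsh_partial_sum _ f x / _)) => i.
apply: measurable_funM => //.
apply: (@measurable_box_sum 0 _ (fun j x => walsh_coef f j * mwalsh j x)) => j.
by apply: measurable_funM => //; exact: measurable_mwalsh.
Qed.

Let mC := @measurable_unit_cube R d.

Let integrable_mwalsh f j : mu.-integrable cube (EFin \o f) ->
  mu.-integrable cube (EFin \o (fun x => f x * mwalsh j x)).
Proof.
move=> fi; apply: (integrableMl mC fi (measurable_mwalsh j)).
exists 1; split; first exact: num_real.
by move=> M M1 x _ /=; rewrite norm_mwalsh ltW.
Qed.

Lemma walsh_coefB f g j : mu.-integrable cube (EFin \o f) ->
  mu.-integrable cube (EFin \o g) ->
  walsh_coef (fun x => f x - g x) j = walsh_coef f j - walsh_coef g j.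
Proof.
move=> fi gi; rewrite /walsh_coef -RintegralB//; last 2 first.
- exact: integrable_mwalsh.
- exact: integrable_mwalsh.
by apply: eq_Rintegral => x _; rewrite mulrBl.
Qed.

Lemma mixed_log_meanB n f g x : mu.-integrable cube (EFin \o f) ->
  mu.-integrable cube (EFin \o g) ->
  mixed_log_mean B n (fun x => f x - g x) x =
  mixed_log_mean B n f x - mixed_log_mean B n g x.
Proof.
move=> fi gi; rewrite !mixed_log_meanE -mulN1r -log_mean_coefZ -log_mean_coefD.
by congr log_mean_coef; apply/funext => j; rewrite walsh_coefB// mulN1r.
Qed.

Lemma norm_walsh_coef_le f j (e : R) : mu.-integrable cube (EFin \o f) ->
  (\int[mu]_(x in cube) `|f x|%:E <= e%:E)%E -> `|walsh_coef f j| <= e.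
Proof.
move=> fi fe; apply: le_trans (le_normr_Rintegral mC (integrable_mwalsh j fi)) _.
rewrite /Rintegral (eq_integral (fun x => `|f x|%:E)); last first.
  by move=> x _ /=; rewrite normrM norm_mwalsh mulr1.
rewrite -lee_fin fineK// ge0_fin_numE; last by apply: integral_ge0 => x _; rewrite lee_fin.
exact: le_lt_trans fe (ltry _).
Qed.

Lemma mixed_log_mean_bound n : exists2 C : R, 0 < C & forall f e x,
  mu.-integrable cube (EFin \o f) ->
  (\int[mu]_(x in cube) `|f x|%:E <= e%:E)%E ->
  `|mixed_log_mean B n f x| <= C * e.
Proof.
have [C C0 hC] := @log_mean_coef_bound R d B n; exists C => // f e x fi fe.
by rewrite mixed_log_meanE; apply: hC => j; exact: norm_walsh_coef_le.
Qed.

End log_mean_of_functions.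

(** * The gliding hump *)

Section gliding_hump.
Context {R : realType} {d : nat} (B : {set 'I_d}) (phi : R -> R).
Notation point := (d.-tuple (measurableTypeR R)).
Notation cube := (unit_cube R d).
Notation mu := (lebesgue_tuple R d).
Hypothesis B_gt1 : (1 < #|B|)%N.
Hypothesis phi_ge0 : forall x : R, 0 <= x -> 0 <= phi x.
Hypothesis phi_nd : forall x y : R, 0 <= x -> x <= y -> phi x <= phi y.
Hypothesis phi_littleo : forall e : R, 0 < e ->
  \forall x \near +oo, `|phi x| <= e * `|x * ln x ^+ (#|B| - 1)|.
Hypothesis means_bounded : forall f : point -> R,
  mu.-integrable cube (EFin \o f) ->
  (\int[mu]_(x in cube) (phi `|f x|)%:E < +oo)%E ->
  exists A : R, \forall n \near min_oo d,
    (mu (cube `&` [set x | (A <= `|mixed_log_mean B n f x|)%R]) <= (16^-1)%:E)%E.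

Let mC := @measurable_unit_cube R d.

(** Bounded partial sums satisfy both integrability conditions, so [means_bounded] applies to them,
    and the next hump can exceed their bound. *)
Definition tame (P : point -> R) :=
  measurable_fun cube P /\ exists C, forall x, `|P x| <= C.

Let tame_integrable P : tame P -> mu.-integrable cube (EFin \o P).
Proof. by move=> [mP bP]; exact: integrable_unit_cube. Qed.

Let tame_phi P : tame P -> (\int[mu]_(x in cube) (phi `|P x|)%:E < +oo)%E.
Proof.
move=> [mP [C PC]]; apply: le_lt_trans (_ : \int[mu]_(x in cube) cst (phi C)%:E x < _)%E.
  apply: ge0_le_integral => //.
  - by move=> x _; rewrite lee_fin phi_ge0.
  - by apply/measurable_EFinP; exact: measurable_nondecreasing_norm.
  - by move=> x _; rewrite lee_fin; exact: phi_nd.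
by rewrite integral_cst// [X in (_ * X)%E]lebesgue_unit_cube mule1 ltry.
Qed.

(* The last clause leaves room for everything added after P'. *)
Definition glides (s s' : nat * R * (point -> R)) : Prop :=
  let: (k, tau, P) := s in let: (k', tau', P') := s' in
  let h := fun x => P' x - P x in
  [/\ [/\ k' = k.+1, 0 < tau', 2 * tau' <= tau & tame P'],
      [/\ forall x, h x != 0 -> 1 <= `|h x| /\ `|P x| <= `|h x|,
          measurable_fun cube (double_phi phi \o h),
          (\int[mu]_(x in cube) `|h x|%:E <= tau%:E)%E &
          (\int[mu]_(x in cube) (double_phi phi (h x))%:E <= tau%:E)%E] &
      exists n : 'I_d -> nat, [/\ forall i, (k <= n i)%N,
        ((8^-1)%:E <= mu (cube `&` [set x | (k.+1%:R <= `|mixed_log_mean B n P' x|)%R]))%E &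
        forall f x, mu.-integrable cube (EFin \o f) ->
          (\int[mu]_(x in cube) `|f x - P' x|%:E <= (2 * tau')%:E)%E ->
          `|mixed_log_mean B n f x - mixed_log_mean B n P' x| <= 1]].

Lemma hump_glides k tau P : 0 < tau -> tame P ->
  exists s', glides (k, tau, P) s'.
Proof.
move=> tau0 tP; have Pi := tame_integrable tP.
have [A [n0 _ hA]] := means_bounded Pi (tame_phi tP).
have [mP [C PC]] := tP.
(* This level survives subtracting the mean of P, which is below A off a set of measure 1/16; the
   height |C| + 1 makes h dominate P wherever h is nonzero. *)
have M0 : 0 < `|A| + k.+1%:R by rewrite ltr_wpDl.
have [n [N [F [nn0 Flarge intF intphiF hump]]]] :=
  log_mean_hump B_gt1 phi_littleo (`|C| + 1) (maxn n0 k) M0 tau0.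
set h := F \o cell N in Flarge intF intphiF hump.
have th : tame h.
  split; first exact: measurable_fun_cell.
  exists (\sum_c `|F c|) => x; rewrite /h/= (bigD1 (cell N x))//= lerDl.
  exact: sumr_ge0.
pose P' x := P x + h x.
have tP' : tame P'.
  split; first exact: measurable_funD th.1.
  have [mh [C' hC']] := th; exists (C + C') => x.
  by apply: le_trans (ler_normD _ _) _; apply: lerD.
have hEx x : P' x - P x = h x by rewrite /P' addrC addKr.
have hE : (fun x => P' x - P x) = h by exact/funext.
have [K K0 hK] := @mixed_log_mean_bound R d B n.
(* Since n is already fixed, any f within 2 tau' of P' in L1 has its n-th mean within 2 K tau' <= 1
   of that of P'. *)
pose tau' := Num.min (tau / 2) (2 * K)^-1.
exists (k.+1, tau', P'); split.
- split => //.
  + by rewrite lt_min divr_gt0//= invr_gt0 mulr_gt0.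
  + have : tau' <= tau / 2 by rewrite ge_min lexx.
    by lra.
- rewrite hE; split => //.
  + move=> x; rewrite hEx => hx.
    have := Flarge x hx; have := PC x; have := ler_norm C; have := normr_ge0 C.
    by move=> ? ? ? ?; split; lra.
  + rewrite (_ : _ \o _ = (fun c => double_phi phi (F c)) \o cell N)//.
    exact: measurable_fun_cell.
  + by under eq_integral do rewrite hEx.
  + by under eq_integral do rewrite hEx.
exists n; split.
- by move=> i; apply: leq_trans (nn0 i); rewrite leq_maxr.
- have PX : (mu (cube `&` [set x | (A <= `|mixed_log_mean B n P x|)%R]) <= (16^-1)%:E)%E.
    by apply: hA => i; apply: leq_trans (nn0 i); rewrite leq_maxl.
  (* In real numbers, 1/4 - 1/16 >= 1/8. *)
  have split_bound (a b : \bar R) :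
      ((4^-1)%:E <= a + b -> b <= (16^-1)%:E -> (8^-1)%:E <= a)%E.
    case: a => [a| |]; case: b => [b| |]//=; rewrite ?lee_fin ?leey//.
    by move=> ? ?; lra.
  apply: split_bound PX.
  have mS f c : measurable (cube `&` [set x | (c <= `|mixed_log_mean B n f x|)%R]).
    by apply: measurable_superlevel => //; exact: measurable_mixed_log_mean.
  apply: le_trans hump _; apply: le_trans (measureU2 _ (mS _ _) (mS _ _)).
  apply: le_measure; rewrite ?inE//; first exact: measurableU.
  move=> x [Cx /= hx]; case: (leP A `|mixed_log_mean B n P x|) => PA; first by right.
  left; split => //=.
  have := @mixed_log_meanB R d B n P' P x (tame_integrable tP') Pi.
  rewrite hE => hB; rewrite hB in hx.
  have := ler_normB (mixed_log_mean B n P' x) (mixed_log_mean B n P x).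
  by have := ler_norm A; lra.
- move=> f x fi fP; rewrite -mixed_log_meanB//; last exact: tame_integrable.
  have fPi : mu.-integrable cube (EFin \o (fun x => f x - P' x)).
    exact: (integrableB mC fi (tame_integrable tP')).
  apply: le_trans (hK _ _ x fPi fP) _.
  have : tau' <= (2 * K)^-1 by rewrite ge_min lexx orbT.
  rewrite -(@ler_pM2l _ (2 * K)) ?mulr_gt0// mulfV ?lt0r_neq0 ?mulr_gt0//.
  by lra.
Qed.

Lemma not_all_means_bounded : False.
Proof.
(* The invariant is part of the state, since [dependent_choice] needs a successor for every
   state. *)
pose S := {s : nat * R * (point -> R) | 0 < s.1.2 /\ tame s.2}.
have step (s : S) : {s' : S | glides (sval s) (sval s')}.
  case: s => [[[k tau] P] [/= tau0 tP]]; apply: cid.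
  have [[[k' tau'] P'] g] := hump_glides k tau0 tP.
  have inv : 0 < tau' /\ tame P' by case: g => -[].
  by exists (exist _ (k', tau', P') inv).
have inv0 : 0 < (0%N, 1 : R, (fun=> 0) : point -> R).1.2 /\ tame (0%N, 1 : R, (fun=> 0) : point -> R).2.
  by split => //=; split; [exact: measurable_cst|exists 0 => x; rewrite normr0].
have [s [s0 sS]] := dependent_choice step (exist _ _ inv0).
pose tau k := (sval (s k)).1.2; pose P k := (sval (s k)).2.
have sE k : sval (s k) = (k, tau k, P k).
  rewrite /tau /P; elim: k => [|k ih]; first by rewrite s0.
  have := sS k; rewrite ih /glides; case: (sval (s k.+1)) => -[k' tau'] P'.
  by case=> -[-> _ _ _] _ _.
have g k : glides (k, tau k, P k) (k.+1, tau k.+1, P k.+1) by rewrite -!sE.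
pose h k x := P k.+1 x - P k x.
have sum_h k x : \sum_(i < k) h i x = P k x.
  rewrite -(big_mkord predT (fun i => P i.+1 x - P i x)) telescope_sumr//.
  by rewrite /P s0/= subr0.
have tP k : tame (P k) by rewrite /P; case: (s k) => s' /= [].
have tau_gt0 k : 0 < tau k by rewrite /tau; case: (s k) => s' /= [].
have cube_fin : (mu cube < +oo)%E by rewrite [X in (X < _)%E]lebesgue_unit_cube ltry.
have [||||||f [fi fphi fP]] := @sum_of_humps R _ _ mu cube phi h tau mC cube_fin phi_ge0 phi_nd.
- by move=> k; apply: measurable_funB; [case: (tP k.+1)|case: (tP k)].
- by move=> k; have [_ [_ ? _ _] _] := g k.
- by move=> k x; rewrite sum_h; have [_ [+ _ _ _] _] := g k; exact.
- by move=> k; split; [exact: ltW|have [[_ _ ? _] _ _] := g k].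
- by move=> k; have [_ [_ _ ? _] _] := g k.
- by move=> k; have [_ [_ _ _ ?] _] := g k.
have [A [n0 _ hA]] := means_bounded fi fphi.
(* k >= n0 puts n in the range where A is a bound; k >= |A| ensures that a mean of size k + 1,
   changed by at most 1, is still at least A. This happens on measure 1/8, against the allowed
   1/16. *)
pose k := maxn n0 (Num.bound `|A|).
have [_ _ [n [nk hn fn]]] := g k.
have Ak : A <= k%:R.
  apply: le_trans (ler_norm A) _; apply: le_trans (ltW (archi_boundP (normr_ge0 A))) _.
  by rewrite ler_nat leq_maxr.
have small : (mu (cube `&` [set x | (A <= `|mixed_log_mean B n f x|)%R]) <= (16^-1)%:E)%E.
  by apply: hA => i; apply: leq_trans (nk i); rewrite leq_maxl.
suff : ((8^-1)%:E <= (16^-1)%:E :> \bar R)%E by rewrite lee_fin; lra.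
apply: le_trans hn _; apply: le_trans small.
have mS f' c : measurable (cube `&` [set x | (c <= `|mixed_log_mean B n f' x|)%R]).
  by apply: measurable_superlevel => //; exact: measurable_mixed_log_mean.
apply: le_measure; rewrite ?inE// => x [Cx /= hx]; split => //=.
have fk : (\int[mu]_(x in cube) `|f x - P k.+1 x|%:E <= (2 * tau k.+1)%:E)%E.
  by have := fP k.+1; under eq_integral do rewrite sum_h.
have := fn f x fi fk; have := lerB_dist (mixed_log_mean B n (P k.+1) x) (mixed_log_mean B n f x).
rewrite distrC; move: hx; rewrite -natr1; lra.
Qed.

End gliding_hump.

Theorem corollary1 (R : realType) (d : nat) (B : {set 'I_d}) (phi : R -> R)
    (d_ge2 : (2 <= d)%N)
    (B_gt1 : (1 < #|B|)%N)
    (phi_ge0 : forall x : R, 0 <= x -> 0 <= phi x)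
    (phi_nondecreasing : forall x y : R, 0 <= x -> x <= y -> phi x <= phi y)
    (phi_littleo :
       forall e : R, 0 < e ->
         \forall x \near +oo, `|phi x| <= e * `|x * ln x ^+ (#|B| - 1)|) :
  exists f : d.-tuple (measurableTypeR R) -> R,
    [/\ (lebesgue_tuple R d).-integrable (unit_cube R d) (EFin \o f),
        (\int[lebesgue_tuple R d]_(x in unit_cube R d) (phi `|f x|)%:E < +oo)%E
      & ~ exists g : d.-tuple (measurableTypeR R) -> \bar R,
          [/\ measurable_fun (unit_cube R d) g,
              {ae lebesgue_tuple R d,
                 forall x, unit_cube R d x -> g x \is a fin_num}
            & cvg_in_measure (lebesgue_tuple R d) (unit_cube R d) (min_oo d)
                (fun n => mixed_log_mean B n f) g]].
Proof.
apply: contrapT => nf.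
apply: (not_all_means_bounded B_gt1 phi_ge0 phi_nondecreasing phi_littleo).
move=> f fi fphi.
have [g [mg gfin fg]] : exists g : d.-tuple (measurableTypeR R) -> \bar R,
    [/\ measurable_fun (unit_cube R d) g,
        {ae lebesgue_tuple R d, forall x, unit_cube R d x -> g x \is a fin_num}
      & cvg_in_measure (lebesgue_tuple R d) (unit_cube R d) (min_oo d)
          (fun n => mixed_log_mean B n f) g].
  by apply: contrapT => ng; apply: nf; exists f.
apply: (cvg_in_measure_bounded _ _ _ mg gfin fg) => //.
- exact: measurable_unit_cube.
- by rewrite [X in (X < _)%E]lebesgue_unit_cube ltry.
- by move=> n; exact: measurable_mixed_log_mean.
Qed.
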